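(* Let $\rho:\mathbb R^n\times A\to\mathbb R_+$ be a continuous function. (i) One has $\lim_{\varepsilon\to0^+}\mathcal V^\rho_\varepsilon(x)=\mathcal U^\rho(x)$ for all $x\in\mathcal T^c$, and $\mathcal U^\rho\equiv\mathcal V$ if either $\mathcal V^f=\mathcal V$ or $\mathcal U^\rho$ is continuous on $\partial\mathcal T$. (ii) If there is some $\bar\varepsilon>0$ such that $\mathcal V^\rho_{\bar\varepsilon}$ is continuous on $\partial\mathcal T$ and $\mathcal V$ is continuous on its whole domain $Dom(\mathcal V)$, then $\mathcal U^\rho\equiv\mathcal V$ and the limit $\lim_{\varepsilon\to0^+}\mathcal V^\rho_\varepsilon=\mathcal U^\rho$ is uniform on any compact set $Q\subset Dom(\mathcal V)$.
   Context: Standing setting. $A\subset\mathbb R^m$ is compact; the target $\mathcal T\subset\mathbb R^n$ is closed with compact boundary; $\mathcal T^c=\mathbb R^n\setminus\mathcal T$, $\overset{\circ}{\mathcal T}$ is the interior of $\mathcal T$, $\mathbb R_+=[0,+\infty[$. The functions $f:\mathbb R^n\times A\to\mathbb R^n$ and $l:\mathbb R^n\times A\to\mathbb R_+$ are continuous; there is $M>0$ with $|f(x,a)|\le M(1+|x|)$ for all $(x,a)$, and for every $R>0$ there is $L_R>0$ with $|f(x_1,a)-f(x_2,a)|\le L_R|x_1-x_2|$ and $|l(x_1,a)-l(x_2,a)|\le L_R|x_1-x_2|$ whenever $|x_1|,|x_2|\le R$, $a\in A$. $\mathcal A$ is the set of measurable controls $\alpha:\mathbb R_+\to A$, and $y_x(\cdot,\alpha)$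 is the solution on $\mathbb R_+$ of $\dot y(t)=f(y(t),\alpha(t))$, $y(0)=x$. Put $t_x(\alpha)=\inf\{t\ge0: y_x(t,\alpha)\in\mathcal T\}\le+\infty$, $\mathcal J(t,x,\alpha)=\int_0^t l(y_x(s,\alpha),\alpha(s))\,ds$, $\mathcal A(x)=\{\alpha\in\mathcal A:\ \liminf_{t\to t_x(\alpha)^-}\mathrm{dist}(y_x(t,\alpha),\mathcal T)=0\}$, and $\mathcal A_\rho(x)=\{\alpha\in\mathcal A(x):\ \int_0^{t_x(\alpha)}\rho(y_x(t,\alpha),\alpha(t))\,dt<+\infty\}$. For $x\in\mathcal T^c$ and $\varepsilon>0$ (with $\inf\emptyset=+\infty$): $\mathcal V(x)=\inf_{\alpha\in\mathcal A(x)}\mathcal J(t_x(\alpha),x,\alpha)$, $\mathcal V^f(x)=\inf_{\{\alpha\in\mathcal A:\,t_x(\alpha)<+\infty\}}\mathcal J(t_x(\alpha),x,\alpha)$, $\mathcal U^\rho(x)=\inf_{\alpha\in\mathcal A_\rho(x)}\mathcal J(t_x(\alpha),x,\alpha)$, $\mathcal V^\rho_\varepsilon(x)=\inf_{\alpha\in\mathcal A(x)}\int_0^{t_x(\alpha)}[l(y_x(\tau,\alpha),\alpha(\tau))+\varepsilon\rho(y_x(\tau,\alpha),\alpha(\tau))]\,d\tau$. All these functions are $0$ on $\mathcal T$. ''Continuous on $\partial\mathcal T$'' means continuous at each point of $\partial\mathcal T$ as a function on $\mathbb R^n\setminus\overset{\circ}{\mathcal T}$. $Dom(\mathcal V)=\{x\in\mathbb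 R^n\setminus\overset{\circ}{\mathcal T}:\mathcal V(x)<+\infty\}$. *)

(* Defs.v *)
From HB Require Import structures.
From mathcomp Require Import all_boot all_order all_algebra.
From mathcomp Require Import all_classical all_reals all_analysis.

Set Implicit Arguments.
Unset Strict Implicit.
Unset Printing Implicit Defensive.

Import Order.TTheory GRing.Theory Num.Theory.
Import numFieldNormedType.Exports.

Local Open Scope classical_set_scope.
Local Open Scope ring_scope.

(* R^n is 'rV[R]_n with the library's (sup) norm and distance. Every use of
   the norm below (linear growth, local Lipschitz continuity, vanishing of a
   liminf of distances) is unchanged under an equivalent norm.

   The functions f, l and rho are total on R^n * R^m, but only their values
   on R^n * A matter; likewise only the values of controls and trajectories
   at times t >= 0 matter. *)

(* The real line with the sigma-algebra of Lebesgue measurable sets (the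
   domain of the completed Lebesgue measure), instead of the Borel sets. *)
Definition lebesgueType (R : realType) :=
  caratheodory_type (mu_ext (@wlength R idfun)).

Notation leb := completed_lebesgue_measure.

Definition controls (R : realType) (m : nat) (A : set 'rV[R]_m) :
    set (R -> 'rV[R]_m) :=
  [set al | (forall t, 0 <= t -> A (al t)) /\
    forall i, measurable_fun (`[0, +oo[%classic : set (lebesgueType R))
                (fun t => al t ord0 i)].

(* Caratheodory solution on [0, +oo[ of z' = f (z, al), z 0 = x: z is the
   indefinite Lebesgue integral of f (z, al), equivalently z is locally
   absolutely continuous and satisfies the equation almost everywhere. *)
Definition is_solution (R : realType) (n m : nat)
    (f : 'rV[R]_n -> 'rV[R]_m -> 'rV[R]_n)
    (x : 'rV[R]_n) (al : R -> 'rV[R]_m) (z : R -> 'rV[R]_n) : Prop :=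
  forall (t : R) (i : 'I_n), 0 <= t ->
    leb.-integrable `[0, t] (fun s => (f (z s) (al s) ord0 i)%:E) /\
    z t ord0 i = x ord0 i + \int[leb]_(s in `[0, t]) f (z s) (al s) ord0 i.

(* The first time at which z lies in T, +oo if there is none. *)
Definition hitting_time (R : realType) (n : nat) (T : set 'rV[R]_n)
    (z : R -> 'rV[R]_n) : \bar R :=
  ereal_inf [set t%:E | t in [set t : R | 0 <= t /\ T (z t)]].

(* Integral over [0, tau[, where tau may be +oo. *)
Definition integral_upto (R : realType) (tau : \bar R) (g : R -> R) : \bar R :=
  (\int[leb]_(s in [set s : R | (0 <= s)%R /\ s%:E < tau]) (g s)%:E)%E.

(* liminf of dist (z s, T) as s tends to tau from the left, tau <= +oo; the
   real time s is fine u for u in the left neighbourhoods of tau in \bar R.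
   The distance to an empty T is +oo. *)
Definition liminf_dist (R : realType) (n : nat) (T : set 'rV[R]_n)
    (z : R -> 'rV[R]_n) (tau : \bar R) : \bar R :=
  limf_einf (fun u : \bar R => edist_inf T (z (fine u)))
    (within [set u | (u < tau)%E] (nbhs tau)).

(* From here on, y x al stands for the trajectory issuing from x under al. *)

Definition controls_to (R : realType) (n m : nat) (A : set 'rV[R]_m)
    (T : set 'rV[R]_n) (y : 'rV[R]_n -> (R -> 'rV[R]_m) -> R -> 'rV[R]_n)
    (x : 'rV[R]_n) : set (R -> 'rV[R]_m) :=
  [set al | controls A al /\
    liminf_dist T (y x al) (hitting_time T (y x al)) = 0%E].

Definition total_cost (R : realType) (n m : nat) (T : set 'rV[R]_n)
    (y : 'rV[R]_n -> (R -> 'rV[R]_m) -> R -> 'rV[R]_n)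
    (l : 'rV[R]_n -> 'rV[R]_m -> R)
    (x : 'rV[R]_n) (al : R -> 'rV[R]_m) : \bar R :=
  integral_upto (hitting_time T (y x al)) (fun s => l (y x al s) (al s)).

Definition controls_to_rho (R : realType) (n m : nat) (A : set 'rV[R]_m)
    (T : set 'rV[R]_n) (y : 'rV[R]_n -> (R -> 'rV[R]_m) -> R -> 'rV[R]_n)
    (rho : 'rV[R]_n -> 'rV[R]_m -> R) (x : 'rV[R]_n) :
    set (R -> 'rV[R]_m) :=
  [set al | controls_to A T y x al /\ (total_cost T y rho x al < +oo)%E].

Definition value (R : realType) (n m : nat) (A : set 'rV[R]_m)
    (T : set 'rV[R]_n) (y : 'rV[R]_n -> (R -> 'rV[R]_m) -> R -> 'rV[R]_n)
    (l : 'rV[R]_n -> 'rV[R]_m -> R) (x : 'rV[R]_n) : \bar R :=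
  if x \in T then 0%E
  else ereal_inf (total_cost T y l x @` controls_to A T y x).

Definition value_fin (R : realType) (n m : nat) (A : set 'rV[R]_m)
    (T : set 'rV[R]_n) (y : 'rV[R]_n -> (R -> 'rV[R]_m) -> R -> 'rV[R]_n)
    (l : 'rV[R]_n -> 'rV[R]_m -> R) (x : 'rV[R]_n) : \bar R :=
  if x \in T then 0%E
  else ereal_inf (total_cost T y l x @`
    [set al | controls A al /\ (hitting_time T (y x al) < +oo)%E]).

Definition value_rho (R : realType) (n m : nat) (A : set 'rV[R]_m)
    (T : set 'rV[R]_n) (y : 'rV[R]_n -> (R -> 'rV[R]_m) -> R -> 'rV[R]_n)
    (l rho : 'rV[R]_n -> 'rV[R]_m -> R) (x : 'rV[R]_n) : \bar R :=
  if x \in T then 0%E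
  else ereal_inf (total_cost T y l x @` controls_to_rho A T y rho x).

Definition value_eps (R : realType) (n m : nat) (A : set 'rV[R]_m)
    (T : set 'rV[R]_n) (y : 'rV[R]_n -> (R -> 'rV[R]_m) -> R -> 'rV[R]_n)
    (l rho : 'rV[R]_n -> 'rV[R]_m -> R) (eps : R) (x : 'rV[R]_n) : \bar R :=
  if x \in T then 0%E
  else ereal_inf (total_cost T y (fun z a => l z a + eps * rho z a) x @`
    controls_to A T y x).

Definition boundary (X : topologicalType) (T : set X) : set X :=
  closure T `\` T°.

Definition continuous_on_boundary (R : realType) (n : nat)
    (T : set 'rV[R]_n) (v : 'rV[R]_n -> \bar R) : Prop :=
  forall x, boundary T x -> v z @[z --> within (~` T°) (nbhs x)] --> v x.

Definition dom (R : realType) (n : nat) (T : set 'rV[R]_n)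
    (v : 'rV[R]_n -> \bar R) : set 'rV[R]_n :=
  [set x | (~` T°) x /\ (v x < +oo)%E].

(* Main.v *)
Require Import Defs.
From HB Require Import structures.
From mathcomp Require Import all_boot all_order all_algebra.
From mathcomp Require Import all_classical all_reals all_analysis.
From mathcomp Require Import measurable_realfun ring lra.

Set Implicit Arguments.
Unset Strict Implicit.
Unset Printing Implicit Defensive.

Import Order.TTheory GRing.Theory Num.Theory.
Import numFieldNormedType.Exports.

Local Open Scope classical_set_scope.
Local Open Scope ring_scope.

(* Always V <= U <= V_eps, and V_eps x --> U x because a control whose rho-cost
   is finite costs at most its l-cost plus eps times that rho-cost.
   The other claims rest on dynamic programming: an admissible control for x
   brings the trajectory close to T at some time t before it is hit; if the
   value function W = U (or V_eps) is small near T, one may follow the control up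
   to t and then switch to one of small cost. Up to the finite time t the state
   stays in a ball, where rho is bounded, so that the rho-cost of the first part
   is finite, and negligible after multiplication by a small eps. Hence U <= V.
   Since continuity of W on the compact boundary of T makes W uniformly small
   near T, this gives U = V. By continuous dependence on x the same switching
   bounds V_eps x by V x0 + d for all x near x0 and all small eps; with the lower
   semicontinuity of V this makes the convergence locally uniform, hence uniform
   on compact sets. *)

(** * Translation invariance of the completed Lebesgue measure *)

(** A control in [controls_to] may approach T only asymptotically, with hitting time +oo. Its
    rho-cost can then be infinite while its l-cost is finite, and this is what can separate U from
    V; cutting such a control at a finite time and replacing its tail removes the obstruction. The
    switch requires that the trajectory under the concatenated control be the first trajectory
    followed by the second. Since [y] is merely some solution for each initial point and control,
    this has to be derived: after a translation of time both pieces solve the same integral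
    equation, and uniqueness, a consequence of the local Lipschitz condition, identifies them.
    Controls are Lebesgue measurable rather than Borel, so translation invariance is established for
    the completed measure, starting from the outer measure. Costs stay in the extended reals with
    nonnegative integrands, so that splitting a cost at time t and expanding it in eps are valid
    even when it is infinite. *)

Section completed_lebesgue.
Context {R : realType}.

Notation mu_star := (mu_ext (@wlength R idfun)).

Lemma ocitv_shift (c : R) (X : set R) :
  ocitv X -> ocitv ((fun s : R => (c + s)%R) @^-1` X).
Proof.
move=> [[a b] _ <-] /=; exists (a - c, b - c) => //=.
by apply/seteqP; split => s /=; rewrite !in_itv/= ltrBlDl lerBrDl.
Qed.

Lemma wlength_shift (c : R) (X : set R) : ocitv X ->
  wlength idfun ((fun s : R => (c + s)%R) @^-1` X : set (ocitv_type R)) =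
  wlength idfun (X : set (ocitv_type R)).
Proof.
move=> /ocitvP[->|[[a b] /= ab ->]]; first by rewrite preimage_set0.
have -> : (fun s : R => (c + s)%R) @^-1` `]a, b]%classic = `]a - c, b - c]%classic.
  by apply/seteqP; split => s /=; rewrite !in_itv/= ltrBlDl lerBrDl.
rewrite !wlength_itv_bnd ?lerD2r ?ltW//=.
by congr (_%:E); ring.
Qed.

(** Translating a cover of X by half-open intervals gives a cover of the translate with the same
    total length. The opposite inequality is this one for the opposite translation. *)
Lemma mu_ext_shift_le (c : R) (X : set R) :
  (mu_star ((fun s : R => (c + s)%R) @^-1` X) <= mu_star X)%E.
Proof.
apply: le_ereal_inf_tmp => _ [F [mF XF] <-].
apply: ereal_inf_lbound.
have shF : @measurable_cover _ (ocitv_type R) ((fun s : R => (c + s)%R) @^-1` X)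
    (fun k => (fun s : R => (c + s)%R) @^-1` (F k)).
  split=> [k|]; first exact: (ocitv_shift _ (mF k)).
  by rewrite -preimage_bigcup; exact: preimage_subset.
exists (fun k => (fun s : R => (c + s)%R) @^-1` (F k)) => //.
by apply: eq_eseriesr => k _; exact: (wlength_shift _ (mF k)).
Qed.

Lemma mu_ext_shift (c : R) (X : set R) :
  mu_star ((fun s : R => (c + s)%R) @^-1` X) = mu_star X.
Proof.
apply/eqP; rewrite eq_le mu_ext_shift_le/=.
have := mu_ext_shift_le (- c) ((fun s : R => (c + s)%R) @^-1` X).
by congr (mu_star _ <= _)%E; apply/seteqP; split => s /=; rewrite addrA subrr add0r.
Qed.

(** Caratheodory measurability is a splitting identity for the outer measure of every test set Y, so
    invariance of the outer measure carries it over, with the translate of Y as test set. *)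
Lemma measurable_shift (c : R) (X : set (lebesgueType R)) :
  measurable X -> measurable ((fun s : lebesgueType R => (c + s : R)) @^-1` X : set (lebesgueType R)).
Proof.
move=> mX.
have {}mX (Y : set R) : mu_star Y = (mu_star (Y `&` X) + mu_star (Y `&` ~` X))%E.
  exact: mX.
suff : forall Y : set R, mu_star Y = (mu_star (Y `&` (fun s : R => (c + s)%R) @^-1` X) +
    mu_star (Y `&` ~` ((fun s : R => (c + s)%R) @^-1` X)))%E by [].
move=> Y; have e Z := esym (mu_ext_shift (- c) Z).
rewrite (e Y) mX [in RHS]e [X in _ = (_ + X)%E]e.
by congr (mu_star _ + mu_star _)%E; apply/seteqP; split => s /=; rewrite addrA subrr add0r.
Qed.

Lemma measurable_fun_shift (c : R) :
  measurable_fun (setT : set (lebesgueType R))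
    (fun s : lebesgueType R => (c + s : R) : lebesgueType R).
Proof. by move=> _ Y mY; rewrite setTI; exact: measurable_shift. Qed.

Lemma measurable_fun_comp_shift {d} {S : sigmaRingType d} (c : R) (D : set R) (g : R -> S) :
  measurable (D : set (lebesgueType R)) ->
  measurable_fun (D : set (lebesgueType R)) g ->
  measurable_fun ((fun s : R => (c + s)%R) @^-1` D : set (lebesgueType R)) (fun s => g (c + s)).
Proof. by move=> mD mg _ Y mY; exact: (measurable_shift c (mg mD Y mY)). Qed.

Lemma leb_shift (c : R) (X : set (lebesgueType R)) : 
  pushforward leb (fun s : lebesgueType R => (c + s : R) : lebesgueType R) X = leb X.
Proof. exact: mu_ext_shift. Qed.

Lemma leb_borel (X : set R) : measurable X -> measurable (X : set (lebesgueType R)).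
Proof. by move=> mX; apply: sub_caratheodory; exact: mX. Qed.

Lemma leb_itv (i : interval R) :
  leb ([set` i] : set (lebesgueType R)) = lebesgue_measure ([set` i] : set R).
Proof. by []. Qed.

Lemma ge0_integral_shift (c : R) (D : set R) (g : R -> \bar R) :
  measurable (D : set (lebesgueType R)) ->
  measurable_fun (D : set (lebesgueType R)) g ->
  (forall s, D s -> 0 <= g s)%E ->
  (\int[leb]_(s in (D : set (lebesgueType R))) g s =
   \int[leb]_(s in ((fun s : R => (c + s)%R) @^-1` D : set (lebesgueType R))) g (c + s)%R)%E.
Proof.
move=> mD mg g0.
have g0' : {in D, forall s, (0 <= g s)%E} by move=> s; rewrite inE; exact: g0.
have /= := @ge0_integral_pushforward _ _ (lebesgueType R) (lebesgueType R) R _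
  (measurable_fun_shift c) leb D g mD mg g0'.
rewrite /comp => <-; refine (eq_measure_integral _ _) => X mX _.
exact: (esym (leb_shift c X)).
Unshelve. exact: measurable_fun_shift. Qed.

(** Positive and negative parts are translated separately, so both sides are the same difference,
    whatever its value. *)
Lemma integral_shift (c : R) (D : set R) (g : R -> \bar R) :
  measurable (D : set (lebesgueType R)) ->
  measurable_fun (D : set (lebesgueType R)) g ->
  (\int[leb]_(s in (D : set (lebesgueType R))) g s =
   \int[leb]_(s in ((fun s : R => (c + s)%R) @^-1` D : set (lebesgueType R))) g (c + s)%R)%E.
Proof.
move=> mD mg.
rewrite integralE [RHS]integralE.
congr (_ - _)%E.
  rewrite (ge0_integral_shift c mD (measurable_funepos mg))//.
  by apply: eq_integral => s _; rewrite !funeposE.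
rewrite (ge0_integral_shift c mD (measurable_funeneg mg))//.
by apply: eq_integral => s _; rewrite !funenegE.
Qed.

End completed_lebesgue.

(** * Measurability along measurable controls *)

Section measurable_composition.
Context {R : realType} {d : measure_display} {S : measurableType d} (n m : nat).
Variables (D : set S) (X : S -> 'rV[R]_n) (Y : S -> 'rV[R]_m).
Hypothesis mD : measurable D.
Hypothesis mX : forall i, measurable_fun D (fun s => X s ord0 i).
Hypothesis mY : forall j, measurable_fun D (fun s => Y s ord0 j).

(* A countable base of neighbourhoods, indexed by rational centers and radii. *)
Let box (q : 'rV[rat]_n * 'rV[rat]_m * rat) (p : 'rV[R]_n * 'rV[R]_m) :=
  (forall i, `|p.1 ord0 i - ratr (q.1.1 ord0 i)| < ratr q.2) /\
  (forall j, `|p.2 ord0 j - ratr (q.1.2 ord0 j)| < ratr q.2).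

Let measurable_coord_ball (c r : R) (h : S -> R) :
  measurable_fun D h -> measurable (D `&` [set s | `|h s - c| < r]).
Proof.
move=> mh.
have : measurable_fun D (fun s => `|h s - c| < r).
  apply: measurable_fun_ltr => //; apply: measurableT_comp => //.
  by apply: measurable_funB => //; exact: measurable_cst.
by move=> /(_ mD [set true] I).
Qed.

Let measurable_box q : measurable (D `&` [set s | box q (X s, Y s)]).
Proof.
have -> : D `&` [set s | box q (X s, Y s)] = D `&`
    (\bigcap_(i in [set: 'I_n]) (D `&` [set s | `|X s ord0 i - ratr (q.1.1 ord0 i)| < ratr q.2]) `&`
    \bigcap_(j in [set: 'I_m]) (D `&` [set s | `|Y s ord0 j - ratr (q.1.2 ord0 j)| < ratr q.2])).
  apply/seteqP; split => s /= [Ds] [sX sY]; split => //.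
    by split => i _ /=; split.
  by split => i; [case: (sX i I)|case: (sY i I)].
apply: measurableI => //; apply: measurableI.
  by apply: fin_bigcap_measurable => // i _; exact: measurable_coord_ball.
by apply: fin_bigcap_measurable => // i _; exact: measurable_coord_ball.
Qed.

Let box_exists (p : 'rV[R]_n * 'rV[R]_m) (W : set ('rV[R]_n * 'rV[R]_m)) : open W -> W p ->
  exists2 q, box q p & box q `<=` W.
Proof.
move=> oW Wp; have /nbhs_ballP[e /= e0 eW] : nbhs p W by exact: open_nbhs_nbhs.
(* The radius is below [e / 2] because [p] and another point of the box are compared through its
   center. *)
have [r] : exists r : rat, ratr r \in `]0, (e / 2)[ by apply: rat_in_itvoo; rewrite divr_gt0.
rewrite in_itv/= => /andP[r0 re].
have approx (c : R) : exists t : rat, `|c - ratr t| < ratr r.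
  have [t] : exists t : rat, ratr t \in `]c - ratr r, (c + ratr r)[.
    by apply: rat_in_itvoo; lra.
  by rewrite in_itv/= => /andP[? ?]; exists t; rewrite ltr_norml; apply/andP; split; lra.
have /choice[t1 Ht1] : forall i : 'I_n, exists t : rat, `|p.1 ord0 i - ratr t| < ratr r.
  by move=> i; exact: approx.
have /choice[t2 Ht2] : forall i : 'I_m, exists t : rat, `|p.2 ord0 i - ratr t| < ratr r.
  by move=> i; exact: approx.
exists (\row_i t1 i, \row_i t2 i, r).
  by split => i /=; rewrite mxE.
move=> p' [/= p'1 p'2]; apply: eW.
have close (u v w : R) : `|u - w| < ratr r -> `|v - w| < ratr r -> `|u - v| < e.
  by move=> uw vw; rewrite -(subrKA w) (le_lt_trans (ler_normD _ _))// (distrC w v); lra.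
split; (split=> // i j; rewrite (ord1 i); apply: close) => /=.
- exact: Ht1.
- by have := p'1 j; rewrite mxE.
- exact: Ht2.
- by have := p'2 j; rewrite mxE.
Qed.

(** W is the union of the countably many boxes it contains, and the preimage of a box only involves
    the coordinates of X and Y. *)
Lemma measurable_open_preimage_pair (W : set ('rV[R]_n * 'rV[R]_m)) :
  open W -> measurable (D `&` [set s | W (X s, Y s)]).
Proof.
move=> oW.
pose B q := if `[< box q `<=` W >] then D `&` [set s | box q (X s, Y s)] else set0.
have -> : D `&` [set s | W (X s, Y s)] = \bigcup_q B q.
  apply/seteqP; split => [s /= [Ds Ws]|s [q _]].
    have [q qs qW] := box_exists oW Ws.
    by exists q => //; rewrite /B asboolT.
  by rewrite /B; case: asboolP => // qW [Ds sq]; split => //; exact: qW.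
apply: countable_bigcupT_measurable => [|q]; first exact: countableP.
by rewrite /B; case: asboolP => // _; exact: measurable_box.
Qed.

(** The preimage of an open ray under G is the trace on E of an open set V. As (X, Y) stays in E, V
    and that preimage pull back to the same subset of D. *)
Lemma measurable_fun_within_continuous_pair (E : set ('rV[R]_n * 'rV[R]_m))
    (G : 'rV[R]_n * 'rV[R]_m -> R) :
  {within E, continuous G} -> (forall s, D s -> E (X s, Y s)) ->
  measurable_fun D (fun s => G (X s, Y s)).
Proof.
move=> cG DE _; apply: (measurability _ (RGenOInfty.measurableE R)) => //.
move=> /= _ [_ [a ->] <-].
have /open_subspaceP[V oV VE] : open (G @^-1` `]a, +oo[%classic : set (subspace E)).
  by move/continuousP : cG; apply; exact: interval_open.
have := measurable_open_preimage_pair oV; congr (measurable _).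
have VG p : E p -> V p <-> (G @^-1` `]a, +oo[%classic) p.
  by move=> Ep; have /seteqP[VG GV] := VE; split => [Vp|Gp]; [case: (VG p)|case: (GV p)].
by apply/seteqP; split => s [Ds Ws]; split => //; apply/(VG _ (DE _ Ds)).
Qed.

End measurable_composition.

(** * Intervals, integral bounds and the sup norm *)

Notation lset D := (D%classic : set (lebesgueType _)).

Section leb_facts.
Context {R : realType}.

Lemma leb_measurable_itv (i : interval R) : measurable (lset [set` i]).
Proof. exact: leb_borel. Qed.

Lemma leb_oc (a b : R) : a <= b -> leb (lset `]a, b]) = (b - a)%:E.
Proof.
move=> ab; rewrite leb_itv lebesgue_measure_itv/= lte_fin.
by move: ab; rewrite le_eqVlt => /predU1P[->|->]; rewrite ?ltxx ?subrr// EFinB.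
Qed.

Lemma Rintegral_oc_bound (h : R -> R) (a b K : R) : a <= b -> 
  leb.-integrable (lset `]a, b]) (fun s => (h s)%:E) ->
  (forall s, a < s <= b -> `|h s| <= K) ->
  `|\int[leb]_(s in lset `]a, b]) h s| <= K * (b - a).
Proof.
move=> ab ih hK.
have mab : measurable (lset `]a, b]) by exact: leb_measurable_itv.
apply: (le_trans (le_normr_Rintegral mab ih)).
have -> : K * (b - a) = \int[leb]_(s in lset `]a, b]) K.
  by rewrite Rintegral_cst//; congr (K * _); exact: (esym (congr1 fine (leb_oc ab))).
apply: le_Rintegral => //.
- exact: (integrable_norm ih).
- apply/integrableP; split; first exact/measurable_EFinP.
  rewrite (eq_integral (cst `|K|%:E))// integral_cst//.
  by rewrite [X in (_ * X)%E](leb_oc ab) -EFinM ltry.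
Qed.

End leb_facts.

Section sup_norm.
Context {R : realType} (n : nat).
Implicit Types v : 'rV[R]_n.

Lemma rV_coord_le v i : `|v ord0 i| <= `|v|.
Proof.
rewrite [leRHS]/Num.norm /= mx_normrE.
by apply/bigmax_geP; right => /=; exists (ord0, i).
Qed.

Lemma rV_norm_le v (r : R) : 0 <= r -> (forall i, `|v ord0 i| <= r) -> `|v| <= r.
Proof.
move=> r0 vr; rewrite [leLHS]/Num.norm /= mx_normrE.
by apply/bigmax_leP; split => // -[i j] _ /=; rewrite (ord1 i).
Qed.

End sup_norm.

(** * Trajectories *)

Section gronwall.
Context {R : realType}.

(* No integral of phi occurs: on a time window of length 1 / (2 L) the
   hypothesis bounds the supremum of phi by twice its initial value. *)
Lemma discrete_gronwall (L t : R) : 0 < L -> exists2 C : R, 0 < C &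
  forall phi : R -> R,
    (exists B, forall s : R, 0 <= s <= t -> phi s <= B) -> 0 <= phi 0 ->
    (forall a b K : R, 0 <= a -> a <= b -> b <= t ->
      (forall s : R, a <= s <= b -> phi s <= K) -> phi b <= phi a + K * L * (b - a)) ->
  forall s : R, 0 <= s <= t -> phi s <= C * phi 0.
Proof.
move=> L0; pose h := (2 * L)^-1.
have h0 : 0 < h by rewrite invr_gt0 mulr_gt0.
pose N := Num.bound (t / h).
exists (2 ^+ N); first exact: exprn_gt0.
move=> phi [B phiB] phi0 step.
suff main k : forall s : R, 0 <= s <= t -> s <= k%:R * h -> phi s <= 2 ^+ k * phi 0.
  move=> s /andP[s0 st]; apply: main; first by rewrite s0.
  rewrite -ler_pdivrMr//.
  have th0 : 0 <= t / h by apply: divr_ge0; [exact: le_trans st|exact: ltW].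
  apply: ltW; apply: le_lt_trans (archi_boundP th0).
  by rewrite ler_pM2r// invr_gt0.
elim: k => [|k IH] s /andP[s0 st].
  rewrite mul0r => s0'; have -> : s = 0 by apply/eqP; rewrite eq_le s0 s0'.
  by rewrite expr0 mul1r.
move=> sk; have [sk'|ks] := leP s (k%:R * h).
  apply: (le_trans (IH s _ sk')); first by rewrite s0.
  rewrite exprS -mulrA; set u := _ * phi 0.
  have : 0 <= u by rewrite mulr_ge0// exprn_ge0.
  by lra.
set a := k%:R * h.
have a0 : 0 <= a by rewrite mulr_ge0// ltW.
have sah : s - a <= h by rewrite /a; move: sk; rewrite -natr1 mulrDl mul1r; lra.
have phia : phi a <= 2 ^+ k * phi 0.
  by apply: IH => //; rewrite a0/=; rewrite (le_trans (ltW ks)).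
pose E := phi @` [set u | a <= u <= s].
have phiE u : a <= u <= s -> phi u <= sup E.
  move=> /andP[au us]; apply: ub_le_sup; last by exists u => //=; rewrite au.
  exists B => _ [w /= /andP[aw ws] <-]; apply: phiB.
  by rewrite (le_trans a0 aw)/= (le_trans ws).
have Lh : L * h = 2^-1.
  by rewrite /h invfM mulrCA mulfV ?mulr1// gt_eqF.
(* On this window [L * (u - a)] is at most 1/2, so the supremum is absorbed into the left side. The
   absolute value is there because [phi] may be negative; if [sup E] is negative, the claim is
   immediate. *)
have : sup E <= phi a + `|sup E| / 2.
  apply: ge_sup; first by exists (phi a), a => //=; rewrite lexx ltW.
  move=> _ [u /= /andP[au us] <-].
  apply: (le_trans (step a u (sup E) a0 au (le_trans us st) _)).
    by move=> w /andP[aw wu]; apply: phiE; rewrite aw (le_trans wu).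
  rewrite lerD2l -Lh mulrA.
  apply: (@le_trans _ _ (`|sup E| * L * (u - a))).
    by rewrite ler_wpM2r ?subr_ge0// ler_wpM2r ?ler_norm ?(ltW L0).
  by rewrite ler_wpM2l ?mulr_ge0 ?(ltW L0)//; lra.
have := phiE s; rewrite lexx (ltW ks) => /(_ erefl) phis.
have pk0 : 0 <= 2 ^+ k * phi 0 by rewrite mulr_ge0// exprn_ge0.
rewrite exprS -mulrA; case: (leP 0 (sup E)) => E0; first by rewrite ger0_norm//; lra.
by lra.
Qed.

End gronwall.

Section trajectories.
Context {R : realType} (n m : nat).
Variable f : 'rV[R]_n -> 'rV[R]_m -> 'rV[R]_n.
Implicit Types (al : R -> 'rV[R]_m) (z : R -> 'rV[R]_n) (x : 'rV[R]_n).

(* Unlike is_solution, this depends only on the values of al on ]0, t] and is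
   stable under translation of time. *)
Definition follows al z (t : R) : Prop := forall (a b : R) i, 0 <= a -> a <= b -> b <= t ->
  leb.-integrable (lset `]a, b]) (fun s => (f (z s) (al s) ord0 i)%:E) /\
  z b ord0 i - z a ord0 i = \int[leb]_(s in lset `]a, b]) f (z s) (al s) ord0 i.

Lemma solution_init x al z : is_solution f x al z -> z 0 = x.
Proof.
move=> sol; apply/rowP => i; have [_ ->] := sol 0 i (lexx 0).
have [/integrableP[mf _] _] := sol 0 i (lexx 0).
have m0 : leb (lset `[0 : R, 0]) = 0%E by rewrite leb_itv lebesgue_measure_itv/= ltxx.
have := null_set_integral (leb_measurable_itv `[0, 0]) mf m0.
by rewrite /Rintegral => ->; rewrite addr0.
Qed.

Lemma solution_follows x al z : is_solution f x al z -> forall t, follows al z t.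
Proof.
move=> sol t a b i a0 ab bt.
have [ib eb] := sol b i (le_trans a0 ab); have [ia ea] := sol a i a0.
have U : `[0, b]%classic = (`[0, a] `|` `]a, b])%classic.
  rewrite -(@itv_bndbnd_setU _ _ (BLeft 0) (BRight a) (BRight b))// bnd_simp//.
split.
  apply: integrableS ib; [exact: leb_measurable_itv|exact: leb_measurable_itv|].
  by rewrite U; exact: subsetUr.
rewrite ea eb opprD addrACA subrr add0r; move: ib; rewrite U => ib.
rewrite Rintegral_setU//; [ring|exact: leb_measurable_itv|exact: leb_measurable_itv|].
apply/disj_setPS => s [/=]; rewrite !in_itv/= => /andP[_ sa] /andP[as_ _].
by move: (lt_le_trans as_ sa); rewrite ltxx.
Qed.

Lemma follows_eq al al' z t : (forall s : R, 0 < s <= t -> al s = al' s) ->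
  follows al z t -> follows al' z t.
Proof.
move=> e H a b i a0 ab bt; have [I1 I2] := H a b i a0 ab bt.
have e' s : s \in lset `]a, b] -> f (z s) (al s) ord0 i = f (z s) (al' s) ord0 i.
  rewrite inE/= in_itv/= => /andP[as_ sb].
  by rewrite e// (le_lt_trans a0 as_) (le_trans sb bt).
split; last by rewrite I2; apply: eq_Rintegral => s /e'.
apply: eq_integrable I1; first exact: leb_measurable_itv.
by move=> s /e' /= ->.
Qed.

Lemma follows_shift (c : R) al z (t : R) : 0 <= c -> follows al z (c + t) ->
  follows (fun s => al (c + s)) (fun s => z (c + s)) t.
Proof.
move=> c0 H a b i a0 ab bt.
have [I1 I2] := H (c + a) (c + b) i (addr_ge0 c0 a0) (etrans (lerD2l c _ _) ab) (etrans (lerD2l c _ _) bt).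
have E : (fun s : R => (c + s)%R) @^-1` `]c + a, c + b]%classic = `]a, b]%classic.
  by apply/seteqP; split => s /=; rewrite !in_itv/= ltrD2l lerD2l.
have /integrableP[mI fI] := I1.
split.
  apply/integrableP; split.
    by have := measurable_fun_comp_shift (c := c) (leb_measurable_itv _) mI; rewrite E.
  have := ge0_integral_shift c (leb_measurable_itv _)
    (measurableT_comp (@abse_measurable R setT) mI) (fun s _ => abse_ge0 _).
  by rewrite E => <-.
rewrite I2 /Rintegral; congr fine; rewrite (integral_shift c) ?E//.
exact: leb_measurable_itv.
Qed.

Lemma follows_increment al z (t a b K : R) : follows al z t -> 0 <= a -> a <= b -> b <= t ->
  0 <= K -> (forall s : R, a < s <= b -> `|f (z s) (al s)| <= K) ->
  `|z b - z a| <= K * (b - a).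
Proof.
move=> H a0 ab bt K0 fK; apply: rV_norm_le => [|i]; first by rewrite mulr_ge0// subr_ge0.
have [I1 I2] := H a b i a0 ab bt.
rewrite !mxE I2; apply: Rintegral_oc_bound => // s /fK; apply: le_trans.
exact: rV_coord_le.
Qed.

Lemma follows_increment2 al z w (t a b K : R) : follows al z t -> follows al w t -> 
  0 <= a -> a <= b -> b <= t ->
  0 <= K -> (forall s : R, a < s <= b -> `|f (z s) (al s) - f (w s) (al s)| <= K) ->
  `|z b - w b| <= `|z a - w a| + K * (b - a).
Proof.
move=> Hz Hw a0 ab bt K0 fK.
rewrite -lerBlDl; apply: (le_trans (lerB_dist _ _)).
apply: rV_norm_le => [|i]; first by rewrite mulr_ge0// subr_ge0.
have [I1 I2] := Hz a b i a0 ab bt; have [J1 J2] := Hw a b i a0 ab bt.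
rewrite !mxE.
have -> : z b ord0 i - w b ord0 i - (z a ord0 i - w a ord0 i) =
  z b ord0 i - z a ord0 i - (w b ord0 i - w a ord0 i) by ring.
rewrite I2 J2 -RintegralB//; last exact: leb_measurable_itv.
apply: Rintegral_oc_bound => //.
  have := integrableB (leb_measurable_itv _) I1 J1.
  by apply: eq_integrable => //; exact: leb_measurable_itv.
by move=> s /fK; apply: le_trans; apply: le_trans (rV_coord_le _ i); rewrite !mxE.
Qed.

(** Integrability of the velocity alone gives a bound, of unspecified size. It supplies the finite
    supremum that [discrete_gronwall] requires before any quantitative estimate can start. *)
Lemma follows_bounded al z t : follows al z t ->
  exists2 r : R, 0 < r & forall s : R, 0 <= s <= t -> `|z s| <= r.
Proof.
move=> H; have [t0|t0] := ltP t 0.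
  by exists 1 => // s /andP[s0 /(le_trans s0)]; rewrite leNgt t0.
pose r i : R := `|z 0 ord0 i| + \int[leb]_(s in lset `]0, t]) `|f (z s) (al s) ord0 i|.
have r0 i : 0 <= r i.
  by apply: addr_ge0 => //; apply: Rintegral_ge0.
have rsum : 0 <= \sum_i r i by exact: sumr_ge0.
(* The sum of the nonnegative [r i] dominates each of them; the 1 makes the bound positive even when
   it vanishes. *)
exists (1 + \sum_i r i); first by rewrite ltr_pwDl.
move=> s /andP[s0 st]; apply: rV_norm_le => [|i]; first by rewrite addr_ge0.
apply: (@le_trans _ _ (r i)); last first.
  by rewrite (bigD1 i)//= addrCA lerDl addr_ge0// sumr_ge0.
have [I1 I2] := H 0 s i (lexx 0) s0 st; have [J1 _] := H 0 t i (lexx 0) t0 (lexx t).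
rewrite -[z s ord0 i](subrK (z 0 ord0 i)) [in leLHS]addrC.
rewrite (le_trans (ler_normD _ _))// /r lerD2l I2.
have mS (u : R) : measurable (lset `]0, u]) by exact: leb_measurable_itv.
apply: (le_trans (le_normr_Rintegral (mS s) I1)).
have /integrableP[mJ _] := J1.
have /integrableP[_ JF] := integrable_norm J1.
rewrite /Rintegral; apply: fine_le.
- rewrite ge0_fin_numE ?integral_ge0//.
  by have /integrableP[_] := integrable_norm I1; under eq_integral do rewrite /= normr_id.
- rewrite ge0_fin_numE ?integral_ge0//.
  by move: JF; under eq_integral do rewrite /= normr_id.
apply: ge0_subset_integral => //.
  by move/measurable_EFinP : mJ => mJ; apply/measurable_EFinP; exact: measurableT_comp.
by move=> u /=; rewrite !in_itv/= => /andP[-> /le_trans->].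
Qed.

End trajectories.

(* At time t itself the first control is used: trajectories are recovered from
   integrals over intervals ]a, b], which ignore the left end point. *)
Definition concat {R : realType} {U : Type} (t : R) (al be : R -> U) : R -> U :=
  fun s => if s <= t then al s else be (s - t).

(** * A priori bounds, stability and concatenation of controlled trajectories *)

Section controlled_dynamics.
Context {R : realType} (n m : nat).
Variables (A : set 'rV[R]_m) (f : 'rV[R]_n -> 'rV[R]_m -> 'rV[R]_n).
Variable y : 'rV[R]_n -> (R -> 'rV[R]_m) -> R -> 'rV[R]_n.
Hypothesis f_growth : exists2 M : R, 0 < M &
  forall x a, A a -> `|f x a| <= M * (1 + `|x|).
Hypothesis f_lipschitz : forall r : R, 0 < r -> exists2 L : R, 0 < L &
  forall (x1 x2 : 'rV[R]_n) a, `|x1| <= r -> `|x2| <= r -> A a ->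
    `|f x1 a - f x2 a| <= L * `|x1 - x2|.
Hypothesis y_solution :
  forall x al, controls A al -> is_solution f x al (y x al).
Implicit Types (al be : R -> 'rV[R]_m) (z w : R -> 'rV[R]_n) (x : 'rV[R]_n).

Lemma controlled_init x al : controls A al -> y x al 0 = x.
Proof. by move=> /(y_solution x)/solution_init. Qed.

Lemma controlled_follows x al t : controls A al -> follows f al (y x al) t.
Proof. by move=> /(y_solution x)/solution_follows. Qed.
Arguments controlled_follows : clear implicits.

(** Linear growth is exactly the Gronwall hypothesis for [1 + |y|]. The bound is uniform in the
    control and in the initial point, which later gives one Lipschitz constant and one bound on rho
    for all trajectories near a given one. *)
Lemma controlled_bounded (r t : R) : exists2 C : R, 0 < C &
  forall x al, `|x| <= r -> controls A al ->
  forall s : R, 0 <= s <= t -> `|y x al s| <= C.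
Proof.
have [M M0 fM] := f_growth; have [C C0 gr] := discrete_gronwall t M0.
exists (C * (1 + `|r|)); first by rewrite mulr_gt0// ltr_pwDl.
move=> x al xr cal s st.
have F := controlled_follows x al t cal.
apply: (@le_trans _ _ (1 + `|y x al s|)); first by rewrite lerDr.
apply: (@le_trans _ _ (C * (1 + `|y x al 0|))).
  apply: (gr (fun s => 1 + `|y x al s|)) => //.
    have [B B0 yB] := follows_bounded F; exists (1 + B) => u ut.
    by rewrite lerD2l yB.
  move=> a b K a0 ab bt phiK.
  have K0 : 0 <= K by apply: le_trans (phiK a _); rewrite ?addr_ge0// lexx.
  have := @follows_increment _ _ _ _ _ _ _ a b (M * K) F a0 ab bt.
  rewrite mulr_ge0 ?(ltW M0)// => /(_ isT) inc.
  have {inc} : `|y x al b - y x al a| <= M * K * (b - a).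
    apply: inc => u /andP[au ub]; have u0 : 0 <= u by rewrite (le_trans a0)// ltW.
    apply: (le_trans (fM _ _ (cal.1 _ u0))); rewrite ler_pM2l//.
    by apply: phiK; rewrite (ltW au).
  rewrite (mulrC K) => inc; rewrite -addrA lerD2l.
  by rewrite -lerBlDl (le_trans (lerB_dist _ _)).
rewrite ler_pM2l// lerD2l controlled_init// (le_trans xr)//.
exact: ler_norm.
Qed.

Lemma controlled_lipschitz x al (t : R) : controls A al ->
  exists2 K : R, 0 < K & forall a b : R, 0 <= a -> a <= b -> b <= t ->
    `|y x al b - y x al a| <= K * (b - a).
Proof.
move=> cal; have [M M0 fM] := f_growth.
have F := controlled_follows x al t cal; have [r r0 yr] := follows_bounded F.
exists (M * (1 + r)); first by rewrite mulr_gt0// addr_gt0.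
move=> a b a0 ab bt; apply: (follows_increment F) => //.
  by rewrite mulr_ge0 ?(ltW M0)// addr_ge0// ltW.
move=> s /andP[as_ sb]; have s0 : 0 <= s by rewrite (le_trans a0)// ltW.
apply: (le_trans (fM _ _ (cal.1 _ s0))); rewrite ler_pM2l// lerD2l.
by apply: yr; rewrite s0 (le_trans sb).
Qed.

(** Gronwall for [|z - w|], with the Lipschitz constant of the ball containing both paths. Stated
    for arbitrary paths, not just values of [y], so that it also yields uniqueness for translated
    trajectories. *)
Lemma follows_stable (r t : R) : 0 < r -> exists2 C : R, 0 < C &
  forall al z w, (forall s : R, 0 < s <= t -> A (al s)) ->
    follows f al z t -> follows f al w t ->
    (forall s : R, 0 <= s <= t -> `|z s| <= r) ->
    (forall s : R, 0 <= s <= t -> `|w s| <= r) ->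
  forall s : R, 0 <= s <= t -> `|z s - w s| <= C * `|z 0 - w 0|.
Proof.
move=> r0; have [L L0 fL] := f_lipschitz r0.
have [C C0 gr] := discrete_gronwall t L0.
exists C => // al z w alA Fz Fw zr wr s st.
apply: (gr (fun s => `|z s - w s|)) => //.
  exists (r + r) => u ut.
  by rewrite (le_trans (ler_normB _ _))// lerD ?zr ?wr.
move=> a b K a0 ab bt phiK; rewrite (mulrC K).
have K0 : 0 <= K by apply: le_trans (phiK a _); rewrite ?lexx.
apply: (follows_increment2 Fz Fw) => //; first by rewrite mulr_ge0// ltW.
move=> u /andP[au ub]; have u0 : 0 < u by rewrite (le_lt_trans a0).
have ut : 0 <= u <= t by rewrite ltW//= (le_trans ub).
apply: (le_trans (fL _ _ _ (zr _ ut) (wr _ ut) (alA _ _))).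
  by rewrite u0 (le_trans ub).
by rewrite ler_pM2l// phiK// (ltW au).
Qed.

Lemma follows_unique al z w (t : R) : (forall s : R, 0 < s <= t -> A (al s)) ->
  follows f al z t -> follows f al w t -> z 0 = w 0 ->
  forall s : R, 0 <= s <= t -> z s = w s.
Proof.
move=> alA Fz Fw zw s st.
have [r1 r10 zr] := follows_bounded Fz; have [r2 r20 wr] := follows_bounded Fw.
have [C C0 stab] := follows_stable t (addr_gt0 r10 r20).
have := stab al z w alA Fz Fw.
rewrite zw subrr normr0 mulr0 => /(_ _ _ s st) H.
apply/eqP; rewrite -subr_eq0 -normr_le0; apply: H => u ut.
  by rewrite (le_trans (zr u ut))// lerDl ltW.
by rewrite (le_trans (wr u ut))// lerDr ltW.
Qed.

Lemma controlled_stable (r t : R) : exists2 C : R, 0 < C &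
  forall (x1 x2 : 'rV[R]_n) al, `|x1| <= r -> `|x2| <= r -> controls A al ->
  forall s : R, 0 <= s <= t -> `|y x1 al s - y x2 al s| <= C * `|x1 - x2|.
Proof.
have [r' r'0 yr] := controlled_bounded r t.
have [C C0 stab] := follows_stable t r'0; exists C => // x1 x2 al x1r x2r cal s st.
have := stab al _ _ _ (controlled_follows x1 al t cal) (controlled_follows x2 al t cal).
rewrite !controlled_init//; apply => //; [|exact: yr|exact: yr].
by move=> u /andP[u0 _]; apply: cal.1; exact: ltW.
Qed.

Lemma controls_concat (t : R) al be : 0 <= t -> controls A al -> controls A be ->
  controls A (concat t al be).
Proof.
move=> t0 [alA mal] [beA mbe]; split=> [s s0|i].
  rewrite /concat; case: leP => [_|ts]; first exact: alA.
  by apply: beA; rewrite subr_ge0 ltW.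
have U : `[0, +oo[%classic = (`[0, t] `|` `]t, +oo[)%classic.
  by rewrite -(@itv_bndbnd_setU _ _ (BLeft 0) (BRight t) (BInfty _ false))// bnd_simp.
rewrite U; apply/measurable_funU; [exact: leb_measurable_itv|exact: leb_measurable_itv|].
split.
  have := mal i; rewrite U => /measurable_funU[]; try exact: leb_measurable_itv.
  move=> + _; apply: eq_measurable_fun => s; rewrite inE/= in_itv/= => /andP[_ st].
  by rewrite /concat st.
have := measurable_fun_comp_shift (c := - t) (leb_measurable_itv `[0, +oo[) (mbe i).
have E : (fun s : R => (- t + s)%R) @^-1` `[0, +oo[%classic = (`[t, +oo[)%classic.
  by apply/seteqP; split => s /=; rewrite !in_itv/= !andbT addrC subr_ge0.
rewrite E => mt.
have {}mt : measurable_fun (lset `]t, +oo[) (fun s => be (- t + s)%R ord0 i).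
  apply: measurable_funS mt; first exact: leb_measurable_itv.
  by move=> s /=; rewrite !in_itv/= !andbT => /ltW.
apply: eq_measurable_fun mt => s; rewrite inE/= in_itv/= andbT => ts.
by rewrite /concat leNgt ts/= addrC.
Qed.

Lemma controlled_concat_before x (t : R) al be : 0 <= t -> controls A al -> controls A be ->
  forall s : R, 0 <= s <= t -> y x (concat t al be) s = y x al s.
Proof.
move=> t0 cal cbe; have cc := controls_concat t0 cal cbe.
apply: (@follows_unique al); last by rewrite !controlled_init.
- by move=> s /andP[s0 _]; apply: cal.1; exact: ltW.
- apply: follows_eq (controlled_follows x _ t cc) => s /andP[s0 st].
  by rewrite /concat st.
- exact: controlled_follows.
Qed.

Lemma controlled_concat_after x (t : R) al be : 0 <= t -> controls A al -> controls A be ->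
  forall s : R, 0 <= s -> y x (concat t al be) (t + s) = y (y x al t) be s.
Proof.
move=> t0 cal cbe u u0; have cc := controls_concat t0 cal cbe.
have : 0 <= u <= u by rewrite u0 lexx.
apply: (@follows_unique be (fun s => y x (concat t al be) (t + s)) (y (y x al t) be) u).
- by move=> s /andP[s0 _]; apply: cbe.1; exact: ltW.
(* At s = 0 the translated control still takes the value [al t], but [follows] only sees []0, u]],
   where it equals [be]. *)
- have := follows_shift t0 (controlled_follows x _ (t + u) cc).
  apply: follows_eq => s /andP[s0 _].
  by rewrite /concat -subr_ge0 opprD addNKr leNgt oppr_lt0 s0/= [t + s]addrC addrK.
- exact: controlled_follows.
- by rewrite addr0 controlled_init// controlled_concat_before// t0 lexx.
Qed.

End controlled_dynamics.

(** * Hitting times and running costs *)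

Section hitting.
Context {R : realType} (n : nat).
Variable T : set 'rV[R]_n.
Implicit Types (z w v : R -> 'rV[R]_n).

(** Times below 0 are left out because solutions are unconstrained there. *)
Definition locally_lipschitz_path z := forall t : R, exists2 K : R, 0 < K &
  forall a b : R, 0 <= a -> a <= b -> b <= t -> `|z b - z a| <= K * (b - a).

Lemma hitting_time_ge0 z : (0 <= hitting_time T z)%E.
Proof. by apply: le_ereal_inf_tmp => _ [s [s0 _] <-]; rewrite lee_fin. Qed.

Lemma hitting_time_le z (s : R) : 0 <= s -> T (z s) -> (hitting_time T z <= s%:E)%E.
Proof. by move=> s0 Ts; apply: ereal_inf_lbound; exists s. Qed.

Lemma lt_hitting_time z (s : R) : 0 <= s -> (s%:E < hitting_time T z)%E -> ~ T (z s).
Proof. by move=> s0 + Ts; rewrite ltNge (hitting_time_le s0 Ts). Qed.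

Lemma hitting_time_attained z (t : R) : closed T -> locally_lipschitz_path z ->
  hitting_time T z = t%:E -> 0 <= t /\ T (z t).
Proof.
move=> Tcl zlip zt; have t0 : 0 <= t by rewrite -lee_fin -zt hitting_time_ge0.
split=> //; apply: contrapT => nT.
have /nbhs_ballP[e /= e0 eT] : nbhs (z t) (~` T).
  by apply: open_nbhs_nbhs; split => //; exact: closed_openC.
have [K K0 zK] := zlip (t + 1).
(* The 1 keeps the later times in the window where K is valid; within time [e / K] the path cannot
   leave the ball around [z t], hence cannot enter T. *)
have d0 : 0 < Num.min 1 (e / K) by rewrite lt_min ltr01 divr_gt0.
have : (hitting_time T z < (t + Num.min 1 (e / K))%:E)%E.
  by rewrite zt lte_fin ltrDl.
move=> /ereal_inf_lt[_ [s [s0 Ts] <-]]; rewrite lte_fin => st.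
have ts : t <= s by rewrite -lee_fin -zt hitting_time_le.
have [s1 se] : s - t < 1 /\ s - t < e / K.
  by apply/andP; rewrite -lt_min ltrBlDl.
apply: (eT (z s)) => //; rewrite mx_norm_ball /ball_/= distrC.
apply: (le_lt_trans (zK _ _ t0 ts _)); first by lra.
by rewrite mulrC -ltr_pdivlMr.
Qed.

Lemma hitting_time_gt0 z : closed T -> locally_lipschitz_path z -> ~ T (z 0) ->
  (0 < hitting_time T z)%E.
Proof.
move=> Tcl zlip nT; rewrite lt_neqAle hitting_time_ge0 andbT; apply/eqP => h0.
by have [_] := hitting_time_attained Tcl zlip (esym h0).
Qed.

Lemma hitting_time_shift w v (t : R) : 0 <= t ->
  (forall s : R, 0 <= s <= t -> ~ T (w s)) ->
  (forall s : R, 0 <= s -> w (t + s) = v s) ->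
  hitting_time T w = (t%:E + hitting_time T v)%E.
Proof.
move=> t0 wT wv; apply/eqP; rewrite eq_le; apply/andP; split.
  rewrite -leeBlDl//; apply: le_ereal_inf_tmp => _ [s [s0 Ts] <-].
  by rewrite leeBlDl// -EFinD hitting_time_le ?addr_ge0// wv.
apply: le_ereal_inf_tmp => _ [s [s0 Ts] <-].
have ts : t < s.
  by rewrite ltNge; apply/negP => st; apply: (wT s) => //; rewrite s0.
rewrite -leeBrDl// -EFinB hitting_time_le ?subr_ge0 ?(ltW ts)//.
by rewrite -wv ?subr_ge0 ?(ltW ts)// addrCA subrr addr0.
Qed.

Lemma edist_inf_ltP (x : 'rV[R]_n) (e : R) :
  (edist_inf T x < e%:E)%E <-> exists2 p, T p & `|x - p| < e.
Proof.
split=> [/ereal_inf_lt[_ [p Tp <-]] /edist_lt_ball/= xp|[p Tp xp]].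
  by exists p => //; move: xp; rewrite mx_norm_ball.
have [d /andP[xd de]] : exists d, `|x - p| < d < e.
  by exists ((`|x - p| + e) / 2); apply/andP; split; lra.
apply: (@le_lt_trans _ _ d%:E); last by rewrite lte_fin.
apply: (@le_trans _ _ (edist (x, p))); first by apply: ereal_inf_lbound; exists p.
apply: edist_fin; first exact: le_lt_trans xd.
by rewrite mx_norm_ball.
Qed.

(** Replaces the filter on the extended reals by real times, in one form for finite and infinite
    tau: the path comes within any e of T at times beyond any t0 below tau. *)
Lemma liminf_dist_eq0P z (tau : \bar R) : (0 <= tau)%E ->
  liminf_dist T z tau = 0%E <->
  forall e t0 : R, 0 < e -> (t0%:E < tau)%E ->
    exists s : R, [/\ t0 < s, (s%:E < tau)%E & exists2 p, T p & `|z s - p| < e].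
Proof.
move=> tau0; rewrite /liminf_dist limf_einfE; split.
  move=> sup0 e t0 e0 t0tau.
  pose V := [set u : \bar R | (t0%:E < u)%E /\ (u < tau)%E].
  have FV : within [set u : \bar R | (u < tau)%E] (nbhs tau) V.
    have : nbhs tau [set u : \bar R | (t0%:E < u)%E] by exact: open_ereal_gt'.
    by apply: filterS => u /= tu utau; split.
  have : (ereal_inf ((fun u => edist_inf T (z (fine u))) @` V) < e%:E)%E.
    apply: (@le_lt_trans _ _ 0%E); last by rewrite lte_fin.
    by rewrite -sup0; apply: ereal_sup_ubound; exists V.
  move=> /ereal_inf_lt[_ [u [t0u utau] <-]].
  have : u \is a fin_num by rewrite fin_real// (lt_trans _ t0u) ?ltNyr//= (lt_le_trans utau) ?leey.
  move=> /fineK uE; rewrite -uE !lte_fin in t0u utau *.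
  by move=> /edist_inf_ltP[p Tp zp]; exists (fine u); split => //; exists p.
move=> H; apply/eqP; rewrite eq_le; apply/andP; split; last first.
  apply: (@le_trans _ _ (ereal_inf ((fun u => edist_inf T (z (fine u))) @` setT))).
    by apply: le_ereal_inf_tmp => _ [u _ <-]; exact: edist_inf_ge0.
  by apply: ereal_sup_ubound; exists setT => //; exact: filterT.
apply: ge_ereal_sup => _ [V FV <-]; apply/lee_addgt0Pr => e e0; rewrite add0e.
have [t0 t0tau t0V] : exists2 t0 : R, (t0%:E < tau)%E &
    forall s : R, t0 < s -> (s%:E < tau)%E -> V s%:E.
  case: tau tau0 FV H => [r| |]// _.
  - rewrite /within/= => /(nbhs_ballP (r : R)) [d /= d0 dV] _.
    exists (r - d); first by rewrite lte_fin ltrBlDr ltrDl.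
    move=> s rs sr; apply: dV => //=; move: sr; rewrite lte_fin => sr.
    by rewrite /ball/= ger0_norm ?subr_ge0 ?(ltW sr)//; lra.
  - move=> [M [_ MV]] _; exists M; first by rewrite ltry.
    by move=> s Ms stau; apply: MV => //=; rewrite lte_fin.
have [s [t0s stau zs]] := H e t0 e0 t0tau.
apply/ltW; apply: (@le_lt_trans _ _ (edist_inf T (z s))).
  by apply: ereal_inf_lbound; exists s%:E => //; exact: t0V.
exact/edist_inf_ltP.
Qed.

(** A finite hitting time is attained, and the path is continuous there. Hence the controls
    competing in [value_fin] from a point outside T all belong to [controls_to]. *)
Lemma liminf_dist_hitting_fin z : closed T -> locally_lipschitz_path z ->
  ~ T (z 0) -> (hitting_time T z < +oo)%E ->
  liminf_dist T z (hitting_time T z) = 0%E.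
Proof.
move=> Tcl zlip nT hfin; have h0 := hitting_time_gt0 Tcl zlip nT.
apply/liminf_dist_eq0P; first exact: ltW.
have : hitting_time T z \is a fin_num by rewrite ge0_fin_numE// ltW.
move=> /fineK; set t := fine _ => tE; have [t0 Tt] := hitting_time_attained Tcl zlip (esym tE).
rewrite -tE in h0 *; rewrite lte_fin in h0 => e u e0; rewrite lte_fin => ut.
have [K K0 zK] := zlip t.
(* The three entries, all below t, ensure respectively s > u, s >= 0 and t - s < e / K. *)
pose s := Num.max (Num.max ((u + t) / 2) (t / 2)) (t - e / K / 2).
have eK : 0 < e / K by rewrite divr_gt0.
have [su [s0 [st se]]] : u < s /\ 0 <= s /\ s < t /\ t - s < e / K.
  rewrite /s; split; first by rewrite !lt_max; apply/orP; left; apply/orP; left; lra.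
  split; first by rewrite !le_max; apply/orP; left; apply/orP; right; lra.
  split; first by rewrite !gt_max; apply/andP; split; [apply/andP; split|]; lra.
  apply: (@le_lt_trans _ _ (e / K / 2)); last by lra.
  by rewrite lerBlDl -lerBlDr le_max lexx orbT.
exists s; split => //; exists (z t) => //; rewrite distrC.
apply: (le_lt_trans (zK _ _ s0 (ltW st) (lexx t))).
by rewrite mulrC -ltr_pdivlMr.
Qed.

Lemma liminf_dist_shift w v (t : R) : 0 <= t ->
  (0 < hitting_time T v)%E ->
  (forall s : R, 0 <= s -> w (t + s) = v s) ->
  liminf_dist T v (hitting_time T v) = 0%E ->
  liminf_dist T w (t%:E + hitting_time T v)%E = 0%E.
Proof.
move=> t0 hv wv /(liminf_dist_eq0P _ (ltW hv)) H.
apply/liminf_dist_eq0P; first by rewrite adde_ge0 ?hitting_time_ge0// lee_fin.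
move=> e u e0 ut.
have [|s [us sv [p Tp zp]]] := H e (Num.max (u - t) 0) e0.
  rewrite EFin_max gt_max hv andbT EFinB lteBlDl//.
move: us; rewrite gt_max => /andP[us s0].
exists (t + s); split; first by rewrite -ltrBlDl.
  by rewrite EFinD lteD2lE.
by exists p => //; rewrite wv// ltW.
Qed.

End hitting.

(** * Costs accumulated up to a hitting time *)

Section integral_upto.
Context {R : realType}.
Implicit Types (h k : R -> R) (tau : \bar R) (t : R).

Definition upto tau : set R := [set s : R | 0 <= s /\ (s%:E < tau)%E].

Lemma measurable_upto tau : measurable (lset (upto tau)).
Proof.
case: tau => [r| |].
- have -> : upto r%:E = `[0, r[%classic by apply/seteqP; split=> s; rewrite /upto/= in_itv/= lte_fin => /andP.
  exact: leb_measurable_itv.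
- have -> : upto +oo%E = `[0, +oo[%classic.
    by apply/seteqP; split=> s; rewrite /upto/= in_itv/= ?andbT ?ltry; [case|move=> ->].
  exact: leb_measurable_itv.
- have -> : upto -oo%E = set0 by apply/seteqP; split=> s //= [].
  exact: measurable0.
Qed.

Lemma upto_sub tau : upto tau `<=` `[0, +oo[%classic.
Proof. by move=> s [s0 _] /=; rewrite in_itv/= s0. Qed.

Lemma ge0_integral_upto_prefix (h : R -> R) tau t : (forall s, 0 <= s -> 0 <= h s) ->
  measurable_fun (lset `[0, +oo[) h -> (t%:E < tau)%E ->
  (\int[leb]_(s in lset `[0%R, t]) (h s)%:E <= integral_upto tau h)%E.
Proof.
move=> h0 mh ttau; apply: ge0_subset_integral.
- exact: leb_measurable_itv.
- exact: measurable_upto.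
- apply/measurable_EFinP; apply: measurable_funS mh; [exact: leb_measurable_itv|exact: upto_sub].
- by move=> s [s0 _]; rewrite lee_fin h0.
- move=> s /=; rewrite in_itv/= => /andP[s0 st]; split => //.
  by apply: le_lt_trans ttau; rewrite lee_fin.
Qed.

(** Translation sends []t, t + tau[] to []0, tau[]. The relation between [h] and [k] is asked only
    for s > 0, since a concatenated control still takes its first value at time t; the point 0 is
    restored at the end as a null set. *)
Lemma ge0_integral_upto_shift (h k : R -> R) tau t : 0 <= t -> (0 < tau)%E ->
  (forall s, 0 <= s -> 0 <= h s) -> (forall s, 0 <= s -> 0 <= k s) ->
  measurable_fun (lset `[0, +oo[) h -> measurable_fun (lset `[0, +oo[) k ->
  (forall s, 0 < s -> h (t + s) = k s) ->
  integral_upto (t%:E + tau)%E h =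
  (\int[leb]_(s in lset `[0%R, t]) (h s)%:E + integral_upto tau k)%E.
Proof.
move=> t0 tau0 h0 k0 mh mk hk.
pose D := [set s : R | t < s /\ (s%:E < t%:E + tau)%E].
have DU : upto (t%:E + tau)%E = `[0, t]%classic `|` D.
  apply/seteqP; split => s /=.
    by move=> [s0 st]; rewrite in_itv/= s0/=; case: (leP s t) => ts; [left|right; split].
  move=> [|[ts st]]; last by split => //; rewrite (le_trans t0)// ltW.
  rewrite in_itv/= => /andP[s0 st]; split => //.
  apply: (@le_lt_trans _ _ t%:E); first by rewrite lee_fin.
  by rewrite lteDl.
have E : (fun s : R => (t + s)%R) @^-1` D = [set s : R | 0 < s /\ (s%:E < tau)%E].
  by apply/seteqP; split=> s /=; rewrite /D/= ltrDl EFinD lteD2lE.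
have D0 : D = upto (t%:E + tau)%E `&` `]t, +oo[%classic.
  apply/seteqP; split => s /=; rewrite in_itv/= andbT; first move=> [ts st].
    by split => //; split => //; rewrite (le_trans t0)// ltW.
  by move=> [[_ ?] ?]; split.
have mD : measurable (lset D).
  by rewrite D0; apply: measurableI; [exact: measurable_upto|exact: leb_measurable_itv].
have Dsub : D `<=` `[0, +oo[%classic.
  by move=> s [ts _] /=; rewrite in_itv/= andbT (le_trans t0)// ltW.
have mhE S : measurable (lset S) -> S `<=` `[0, +oo[%classic ->
    measurable_fun (lset S) (fun s => (h s)%:E).
  move=> mS S0; apply/measurable_EFinP; apply: measurable_funS mh => //.
  exact: leb_measurable_itv.
have mkE S : measurable (lset S) -> S `<=` `[0, +oo[%classic ->
    measurable_fun (lset S) (fun s => (k s)%:E).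
  move=> mS S0; apply/measurable_EFinP; apply: measurable_funS mk => //.
  exact: leb_measurable_itv.
have disj S S' : (forall s : R, S s -> S' s -> False) -> [disjoint S & S'].
  by move=> SS; apply/disj_setPS => s [Ss S's]; case: (SS s).
have m0t : measurable (lset `[0 : R, t]) by exact: leb_measurable_itv.
have hU : measurable_fun (lset (`[0, t] `|` D)) (fun s => (h s)%:E).
  by rewrite -DU; apply: mhE; [exact: measurable_upto|exact: upto_sub].
have hU0 s : (`[0, t] `|` D) s -> (0 <= (h s)%:E)%E.
  by rewrite -DU => -[s0 _]; rewrite lee_fin h0.
rewrite [LHS]/integral_upto -/(upto _) DU.
have d1 : [disjoint `[0, t]%classic & D].
  by apply: disj => s /=; rewrite in_itv/= => /andP[_ st] [/(le_lt_trans st)]; rewrite ltxx.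
have -> := ge0_integral_setU leb m0t mD hU hU0 d1.
congr (_ + _)%E.
have Dge0 s : D s -> (0 <= (h s)%:E)%E.
  by move=> [ts _]; rewrite lee_fin h0// (le_trans t0)// ltW.
have -> := ge0_integral_shift t mD (mhE _ mD Dsub) Dge0; rewrite E.
set P := [set s : R | 0 < s /\ (s%:E < tau)%E].
have PE : P = upto tau `&` `]0, +oo[%classic.
  apply/seteqP; split => s /=; rewrite in_itv/= andbT; first move=> [ts st].
    by split => //; split => //; rewrite ltW.
  by move=> [[_ ?] ?]; split.
have mP : measurable (lset P).
  by rewrite PE; apply: measurableI; [exact: measurable_upto|exact: leb_measurable_itv].
have U0 : upto tau = `[(0:R), 0]%classic `|` P.
  apply/seteqP; split => s /=; rewrite in_itv/=.
    move=> [s0 st]; case: (leP s 0) => ss; last by right.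
    by left; rewrite s0.
  by move=> [/le_anti<-|[s0 st]]; split => //; exact: ltW.
have m0 : measurable (lset `[(0:R), 0]) by exact: leb_measurable_itv.
have kU : measurable_fun (lset (`[0 : R, 0] `|` P)) (fun s => (k s)%:E).
  by rewrite -U0; apply: mkE; [exact: measurable_upto|exact: upto_sub].
have kU0 s : (`[0, 0] `|` P) s -> (0 <= (k s)%:E)%E.
  by rewrite -U0 => -[s0 _]; rewrite lee_fin k0.
rewrite /integral_upto -/(upto _) U0.
have d2 : [disjoint `[0 : R, 0]%classic & P].
  by apply: disj => s /=; rewrite in_itv/= => /andP[_ st] [/(le_lt_trans st)]; rewrite ltxx.
have -> := ge0_integral_setU leb m0 mP kU kU0 d2.
have leb0 : leb (lset `[0 : R, 0]) = 0%E by rewrite leb_itv lebesgue_measure_itv/= ltxx.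
have mk0 : measurable_fun (lset `[0 : R, 0]) (fun s => (k s)%:E).
  by apply: mkE => // s /=; rewrite !in_itv/= andbT => /andP[].
have -> := null_set_integral m0 mk0 leb0; rewrite add0e.
by apply: eq_integral => s; rewrite inE => -[s0 _]; rewrite hk.
Qed.

End integral_upto.

Section running_cost.
Context {R : realType} (n m : nat).
Variable A : set 'rV[R]_m.
Implicit Types (g : 'rV[R]_n -> 'rV[R]_m -> R) (al : R -> 'rV[R]_m).

(** What integration requires of a cost. It is stable under nonnegative combinations, so [l], [rho]
    and [l + eps * rho] go through the same concatenation lemmas. *)
Definition running_cost g : Prop := (forall x a, A a -> 0 <= g x a) /\
  forall z al, locally_lipschitz_path z -> controls A al ->
    measurable_fun (lset `[0, +oo[) (fun s => g (z s) (al s)).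

Lemma locally_lipschitz_path_measurable (z : R -> 'rV[R]_n) i :
  locally_lipschitz_path z -> measurable_fun (lset `[0, +oo[) (fun s => z s ord0 i).
Proof.
(* Freezing the path at [z 0] for negative times makes it continuous on the whole line, hence Borel
   and then Lebesgue measurable. *)
move=> zlip; pose w (s : R) : R := z (Num.max 0 s) ord0 i.
have cw : continuous w.
  move=> s; apply/(@cvgrPdist_lt _ R^o) => e e0.
  have [K K0 zK] := zlip (`|s| + 1).
  have lip (a b : R) : `|a| <= `|s| + 1 -> `|b| <= `|s| + 1 -> a <= b ->
      `|w b - w a| <= K * (b - a).
    move=> sa sb ab.
    have m0 : Num.max 0 a <= Num.max 0 b by rewrite ge_max !le_max lexx ab/= orbT.
    apply: (@le_trans _ _ (K * (Num.max 0 b - Num.max 0 a))).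
      apply: le_trans (zK (Num.max 0 a) (Num.max 0 b) _ m0 _).
      - by apply: le_trans (rV_coord_le _ i); rewrite !mxE.
      - by rewrite le_max lexx.
      - by rewrite ge_max addr_ge0//= (le_trans (ler_norm _)).
    rewrite ler_pM2l//; case: (leP 0 a) => a0; case: (leP 0 b) => b0; lra.
  near=> u.
  have us : `|s - u| < 1 by near: u; apply: cvgr_dist_lt => //; exact: cvg_id.
  have uK : `|s - u| < e / K.
    by near: u; apply: cvgr_dist_lt; [exact: cvg_id|exact: divr_gt0].
  have ub : `|u| <= `|s| + 1.
    rewrite -[u](subrK s) (le_trans (ler_normD _ _))// addrC lerD2l distrC ltW//.
  have sb : `|s| <= `|s| + 1 by rewrite lerDl.
  apply: (@le_lt_trans _ _ (K * `|s - u|)); last by rewrite mulrC -ltr_pdivlMr.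
  case: (leP u s) => su.
    by rewrite (ger0_norm (_ : 0 <= s - u)) ?subr_ge0//; exact: lip.
  rewrite (distrC s) (ger0_norm (_ : 0 <= u - s)) ?subr_ge0 ?(ltW su)//.
  by rewrite distrC; apply: lip => //; exact: ltW.
have mw : measurable_fun (lset `[0, +oo[) w.
  move=> mD Y mY; apply: measurableI => //; apply: leb_borel.
  have := continuous_measurable_fun cw; move=> /(_ measurableT Y mY).
  by rewrite setTI.
apply: eq_measurable_fun mw => s; rewrite inE/= in_itv/= andbT => s0.
by rewrite /w max_r.
Unshelve. all: by end_near. Qed.

Lemma continuous_running_cost g : (forall x a, A a -> 0 <= g x a) ->
  {within [set: 'rV[R]_n] `*` A,
    continuous (fun p : 'rV[R]_n * 'rV[R]_m => g p.1 p.2)} ->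
  running_cost g.
Proof.
move=> g0 gc; split; [exact: g0|move=> z al zlip [alA mal]].
apply: (measurable_fun_within_continuous_pair (leb_measurable_itv _) _ mal gc).
  by move=> i; exact: locally_lipschitz_path_measurable.
by move=> s /=; rewrite in_itv/= andbT => s0; split => //=; exact: alA.
Qed.

Lemma running_costD g g' (c : R) : 0 <= c -> running_cost g -> running_cost g' ->
  running_cost (fun x a => g x a + c * g' x a).
Proof.
move=> c0 [g0 mg] [g'0 mg']; split => [x a Aa|z al zlip cal].
  by rewrite addr_ge0 ?g0// mulr_ge0// g'0.
apply: measurable_funD; first exact: mg.
by apply: measurable_funM; [exact: measurable_cst|exact: mg'].
Qed.

End running_cost.

(** * Dynamic programming: splitting the cost at a switching time *)

Section dynamic_programming.
Context {R : realType} (n m : nat).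
Variables (A : set 'rV[R]_m) (T : set 'rV[R]_n).
Variable f : 'rV[R]_n -> 'rV[R]_m -> 'rV[R]_n.
Variable y : 'rV[R]_n -> (R -> 'rV[R]_m) -> R -> 'rV[R]_n.
Hypothesis T_closed : closed T.
Hypothesis f_growth : exists2 M : R, 0 < M &
  forall x a, A a -> `|f x a| <= M * (1 + `|x|).
Hypothesis f_lipschitz : forall r : R, 0 < r -> exists2 L : R, 0 < L &
  forall (x1 x2 : 'rV[R]_n) a, `|x1| <= r -> `|x2| <= r -> A a ->
    `|f x1 a - f x2 a| <= L * `|x1 - x2|.
Hypothesis y_solution :
  forall x al, controls A al -> is_solution f x al (y x al).
Implicit Types (x : 'rV[R]_n) (al be : R -> 'rV[R]_m) (g : 'rV[R]_n -> 'rV[R]_m -> R).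

Lemma controlled_locally_lipschitz x al : controls A al -> locally_lipschitz_path (y x al).
Proof. by move=> cal t; exact: (controlled_lipschitz f_growth y_solution). Qed.

Lemma total_cost_ge0 g x al : running_cost A g -> controls A al -> (0 <= total_cost T y g x al)%E.
Proof.
move=> [g0 _] [alA _]; apply: integral_ge0 => s /= [s0 _].
by rewrite lee_fin g0//; exact: alA.
Qed.

Lemma measurable_running_cost g x al : running_cost A g -> controls A al ->
  measurable_fun (lset `[0, +oo[) (fun s => g (y x al s) (al s)).
Proof. by move=> [_ mg] cal; apply: mg => //; exact: controlled_locally_lipschitz. Qed.

Lemma total_cost_prefix g x al (t : R) : running_cost A g -> controls A al ->
  (t%:E < hitting_time T (y x al))%E ->
  (\int[leb]_(s in lset `[0%R, t]) (g (y x al s) (al s))%:E <= total_cost T y g x al)%E.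
Proof.
move=> cg cal tx; apply: ge0_integral_upto_prefix tx.
  by move=> s s0; apply: cg.1; exact: cal.1.
exact: measurable_running_cost.
Qed.

Lemma total_costD g g' (c : R) x al : 0 <= c -> running_cost A g -> running_cost A g' ->
  controls A al ->
  total_cost T y (fun z a => g z a + c * g' z a) x al =
  (total_cost T y g x al + c%:E * total_cost T y g' x al)%E.
Proof.
move=> c0 cg cg' cal; have [alA _] := cal.
have mU g0 : running_cost A g0 -> measurable_fun (lset (upto (hitting_time T (y x al))))
    (fun s => (g0 (y x al s) (al s))%:E).
  move=> cg0; apply/measurable_EFinP; apply: measurable_funS (measurable_running_cost x cg0 cal).
    exact: leb_measurable_itv.
  exact: upto_sub.
have U0 g0 : running_cost A g0 -> forall s, upto (hitting_time T (y x al)) s ->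
    (0 <= (g0 (y x al s) (al s))%:E)%E.
  by move=> [g00 _] s [s0 _]; rewrite lee_fin g00//; exact: alA.
have mup := measurable_upto (hitting_time T (y x al)).
rewrite /total_cost /integral_upto.
have <- := ge0_integralZl_EFin leb mup (U0 _ cg') (mU _ cg') c0.
have cU0 s : upto (hitting_time T (y x al)) s -> (0 <= c%:E * (g' (y x al s) (al s))%:E)%E.
  by move=> sU; apply: mule_ge0; [rewrite lee_fin|exact: U0 sU].
have mcU : measurable_fun (lset (upto (hitting_time T (y x al)))) (fun s => (c%:E * (g' (y x al s) (al s))%:E)%E).
  by apply: measurable_funeM; exact: mU.
have <- := ge0_integralD leb mup (U0 _ cg) (mU _ cg) cU0 mcU.
by apply: eq_integral => s _; rewrite EFinD EFinM.
Qed.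

Section concatenation.
Variables (x : 'rV[R]_n) (t : R) (al be : R -> 'rV[R]_m).
Hypotheses (t0 : 0 <= t) (cal : controls A al) (cbe : controls A be).
Hypothesis notT : forall s : R, 0 <= s <= t -> ~ T (y x al s).

Let before := controlled_concat_before f_lipschitz y_solution x t0 cal cbe.
Let after := controlled_concat_after f_lipschitz y_solution x t0 cal cbe.

Lemma hitting_time_concat : hitting_time T (y x (concat t al be)) =
  (t%:E + hitting_time T (y (y x al t) be))%E.
Proof.
by apply: hitting_time_shift => // s st; rewrite before//; exact: notT.
Qed.

Lemma hitting_time_concat_gt0 : (0 < hitting_time T (y (y x al t) be))%E.
Proof.
apply: hitting_time_gt0 => //; first exact: controlled_locally_lipschitz.
by rewrite (controlled_init y_solution)//; apply: notT; rewrite t0 lexx.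
Qed.

Lemma controls_to_concat : controls_to A T y (y x al t) be ->
  controls_to A T y x (concat t al be).
Proof.
move=> [_ bel]; split; first exact: controls_concat.
rewrite hitting_time_concat; apply: liminf_dist_shift => //.
exact: hitting_time_concat_gt0.
Qed.

Lemma total_cost_concat g : running_cost A g ->
  total_cost T y g x (concat t al be) =
  (\int[leb]_(s in lset `[0%R, t]) (g (y x al s) (al s))%:E +
   total_cost T y g (y x al t) be)%E.
Proof.
move=> cg; have cc := controls_concat t0 cal cbe.
rewrite /total_cost hitting_time_concat.
have pos x' al' (cal' : controls A al') (s : R) : 0 <= s -> 0 <= g (y x' al' s) (al' s).
  by move=> s0; apply: cg.1; exact: cal'.1.
have -> := ge0_integral_upto_shift t0 hitting_time_concat_gt0 (pos x _ cc) (pos (y x al t) _ cbe)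
   (measurable_running_cost x cg cc) (measurable_running_cost (y x al t) cg cbe).
  congr (_ + _)%E; apply: eq_integral => s; rewrite inE/= in_itv/= => s0t.
  by rewrite before// /concat; case/andP : s0t => _ ->.
move=> s s0; rewrite after ?ltW// /concat -subr_ge0 opprD addNKr leNgt oppr_lt0 s0/=.
by rewrite [t + s]addrC addrK.
Qed.

End concatenation.

End dynamic_programming.

(** * Behaviour near the target *)

Section near_target.
Context {R : realType} (n : nat).
Variable T : set 'rV[R]_n.
Hypothesis T_closed : closed T.

(* q is the first point of T on the segment from z to p. *)
Lemma boundary_between (z p : 'rV[R]_n) : ~ T z -> T p ->
  exists2 q, boundary T q & `|z - q| <= `|z - p|.
Proof.
move=> nTz Tp; pose w (s : R) := z + s *: (p - z).
have wE (a b : R) : a <= b -> `|w b - w a| = `|p - z| * (b - a).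
  move=> ab; have -> : w b - w a = (b - a) *: (p - z).
    by rewrite /w opprD addrACA subrr add0r -scalerBl.
  by rewrite normrZ ger0_norm ?subr_ge0// mulrC.
have wlip : locally_lipschitz_path w.
  move=> t; exists (`|p - z| + 1); first by rewrite ltr_wpDl.
  by move=> a b _ ab _; rewrite wE// ler_wpM2r ?subr_ge0// lerDl.
have w0 : w 0 = z by rewrite /w scale0r addr0.
have w1 : w 1 = p by rewrite /w scale1r addrCA subrr addr0.
have h1 : (hitting_time T w <= 1%:E)%E by apply: hitting_time_le; rewrite ?w1.
have hfin : hitting_time T w \is a fin_num.
  by rewrite ge0_fin_numE ?hitting_time_ge0// (le_lt_trans h1)// ltry.
set t := fine (hitting_time T w).
have tE : hitting_time T w = t%:E by rewrite fineK.
have [t0 Tt] := hitting_time_attained T_closed wlip tE.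
have t1 : t <= 1 by rewrite -lee_fin -tE.
have tgt0 : 0 < t.
  by rewrite lt_neqAle t0 andbT; apply/eqP => t00; apply: nTz; rewrite -w0 t00.
exists (w t).
  split; first exact: subset_closure.
  move=> /nbhs_ballP[e /= e0 eT].
  (* If [w t] were interior to T, the point [w (t - d)] would already lie in T, before the first
     hitting time. The first entry keeps [t - d] nonnegative, the second keeps the point in the
     ball. *)
  pose d := Num.min t (e / (`|p - z| + 1) / 2).
  have pz : 0 < `|p - z| + 1 by rewrite ltr_wpDl.
  have d0 : 0 < d by rewrite lt_min tgt0/= !divr_gt0.
  have dt : d <= t by rewrite ge_min lexx.
  have de : d < e / (`|p - z| + 1).
    apply: (@le_lt_trans _ _ (e / (`|p - z| + 1) / 2)).
      by rewrite ge_min lexx orbT.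
    by have : 0 < e / (`|p - z| + 1) by [exact: divr_gt0]; lra.
  apply: (@lt_hitting_time _ _ T w (t - d)).
  - by rewrite subr_ge0.
  - by rewrite tE lte_fin ltrBlDr ltrDl.
  apply: eT; rewrite mx_norm_ball /ball_/= wE; last by rewrite gerBl ltW.
  rewrite opprB addrCA subrr addr0; move: de; rewrite ltr_pdivlMr// => de.
  by apply: le_lt_trans de; rewrite mulrC ler_wpM2l ?(ltW d0)// lerDl.
rewrite -{1}w0 distrC wE// subr0 distrC ler_piMr//.
Qed.

(** One radius e serves all of T: it must be fixed before the control and the place of the switch
    are known. *)
Definition small_near_target (W : 'rV[R]_n -> \bar R) := forall d : R, 0 < d ->
  exists2 e : R, 0 < e & forall z p, ~ T z -> T p -> `|z - p| < e -> (W z < d%:E)%E.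

(** By [boundary_between], a point outside T and close to T is as close to the boundary, where W is
    continuous and zero; compactness makes the radius uniform. *)
Lemma continuous_small_near_target (W : 'rV[R]_n -> \bar R) :
  compact (boundary T) -> (forall x, T x -> W x = 0%E) ->
  continuous_on_boundary T W -> small_near_target W.
Proof.
move=> /compact_near_coveringP cov W0 cW d d0.
pose P (e : R) (q : 'rV[R]_n) := forall z, ~ T z -> `|z - q| < e -> (W z < d%:E)%E.
have : \forall e \near 0^'+, boundary T `<=` P e.
  apply: cov => q bq.
  have Tq : T q by rewrite (closure_id T).1//; case: bq.
  have : \forall z \near q, (~` T°) z -> (W z < d%:E)%E.
    have : nbhs (W q) [set u | (u < d%:E)%E].
      by rewrite W0//; apply: open_ereal_lt'; rewrite lte_fin.
    exact: cW.
  move=> /nbhs_ballP[r /= r0 rW].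
  exists (ball q (r / 2), [set e | e < r / 2]).
    split => /=; first by apply: nbhsx_ballx; rewrite divr_gt0.
    by apply: nbhs_right_lt; rewrite divr_gt0.
  move=> [q' e] [/= qq' er] z nTz zq'; apply: rW; last first.
    by move=> /interior_subset.
  move: qq'; rewrite !mx_norm_ball /ball_/= => qq'.
  rewrite -(subrKA q') (le_lt_trans (ler_normD _ _))// (distrC q' z); lra.
move=> nP; have [e [e0 eP]] : exists e : R, 0 < e /\ boundary T `<=` P e.
  near (0 : R)^'+ => e; exists e; split; first by near: e; exact: nbhs_right_gt.
  by near: e.
exists e => // z p nTz Tp zp; have [q bq zq] := boundary_between nTz Tp.
by apply: (eP q bq z nTz); exact: le_lt_trans zp.
Unshelve. all: by end_near. Qed.

(** The uniform gap lets every path closer than d to z on [[0, t]] avoid T as well, so a perturbed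
    trajectory can still be switched at t. *)
Lemma path_away_from_target (z : R -> 'rV[R]_n) (t : R) : locally_lipschitz_path z ->
  (forall s : R, 0 <= s <= t -> ~ T (z s)) ->
  exists2 d : R, 0 < d & forall (s : R) p, 0 <= s <= t -> T p -> d <= `|z s - p|.
Proof.
move=> zlip nT; have [K K0 zK] := zlip t.
pose P (d s : R) := forall p, T p -> d <= `|z s - p|.
have : \forall d \near (0 : R)^'+, `[0, t]%classic `<=` P d.
  have /compact_near_coveringP/near_covering_withinP := @segment_compact R 0 t.
  apply => s /=; rewrite in_itv/= => st.
  have /nbhs_ballP[e /= e0 eT] : nbhs (z s) (~` T).
    by apply: open_nbhs_nbhs; split; [exact: closed_openC|exact: nT].
  have eK : 0 < e / 2 / K by rewrite !divr_gt0.
  (* Half of e pays for the motion of the path between the two times, half for the gap d. *)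
  exists (ball s (e / 2 / K), [set d | d < e / 2]).
    split => /=; first exact: nbhsx_ballx.
    by apply: nbhs_right_lt; rewrite divr_gt0.
  move=> [s' d] [/= ss' de]; rewrite in_itv/= => s't p Tp.
  rewrite leNgt; apply/negP => zd; apply: (eT p) => //.
  rewrite mx_norm_ball /ball_/= -(subrKA (z s')).
  apply: (le_lt_trans (ler_normD _ _)).
  suff : `|z s - z s'| < e / 2 by lra.
  move: ss' st s't; rewrite /ball/= => ss' /andP[s0 st] /andP[s'0 s't].
  case: (leP s s') => h.
    rewrite distrC; apply: (le_lt_trans (zK _ _ s0 h s't)).
    by rewrite mulrC -ltr_pdivlMr// -(ger0_norm (_ : 0 <= s' - s)) ?subr_ge0// distrC.
  apply: (le_lt_trans (zK _ _ s'0 (ltW h) st)).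
  by rewrite mulrC -ltr_pdivlMr// -(ger0_norm (_ : 0 <= s - s')) ?subr_ge0 ?(ltW h).
move=> nP; have [d [d0 dP]] : exists d : R, 0 < d /\ `[0, t]%classic `<=` P d.
  near (0 : R)^'+ => d; exists d; split; first by near: d; exact: nbhs_right_gt.
  by near: d.
by exists d => // s p st; apply: (dP s); rewrite /= in_itv.
Unshelve. all: by end_near. Qed.

End near_target.

Lemma continuous_bounded_on_ball {R : realType} (n m : nat) (A : set 'rV[R]_m)
    (g : 'rV[R]_n -> 'rV[R]_m -> R) (r : R) : compact A ->
  {within [set: 'rV[R]_n] `*` A,
    continuous (fun p : 'rV[R]_n * 'rV[R]_m => g p.1 p.2)} ->
  exists2 B : R, 0 < B & forall x a, `|x| <= r -> A a -> g x a <= B.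
Proof.
move=> cA cg; pose D := [set x : 'rV[R]_n | `|x| <= r].
have cD : compact D.
  apply: bounded_closed_compact.
    exists r; split; first exact: num_real.
    by move=> M rM x /= xr; rewrite (le_trans xr)// ltW.
  have -> : D = (fun x : 'rV[R]_n => `|x|) @^-1` [set u : R | u <= r] by [].
  apply: closed_comp; last exact: closed_le.
  by move=> x _; exact: norm_continuous.
have cDA : compact (D `*` A) by exact: compact_setX.
have cgDA : {within D `*` A, continuous (fun p : 'rV[R]_n * 'rV[R]_m => g p.1 p.2)}.
  by apply: continuous_subspaceW cg => p [_ Ap]; split.
have [M [_ MB]] := compact_bounded (continuous_compact cgDA cDA).
exists (`|M| + 1); first by rewrite ltr_wpDl.
move=> x a xr Aa; apply: (le_trans (ler_norm _)).
apply: (MB (`|M| + 1)); first by rewrite (le_lt_trans (ler_norm M))// ltrDl.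
by exists (x, a).
Qed.

Section leb_bounds.
Context {R : realType}.

Lemma leb_cc (t : R) : 0 <= t -> leb (lset `[0%R, t]) = t%:E.
Proof.
move=> t0; rewrite leb_itv lebesgue_measure_itv/= lte_fin.
by move: t0; rewrite le_eqVlt => /predU1P[<-|->]; rewrite ?ltxx// sube0.
Qed.

Lemma ge0_integral_bound (D : set R) (h : R -> R) (B t : R) : 0 <= t -> 0 <= B ->
  measurable (lset D) -> D `<=` `[0, t]%classic -> measurable_fun (lset D) h ->
  (forall s, D s -> 0 <= h s <= B) ->
  (\int[leb]_(s in lset D) (h s)%:E <= (B * t)%:E)%E.
Proof.
move=> t0 B0 mD Dt mh hB.
have h0 s : D s -> (0 <= (h s)%:E)%E by move=> /hB/andP[h0 _]; rewrite lee_fin.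
have mE : measurable_fun (lset D) (fun s => (h s)%:E) by exact/measurable_EFinP.
have mB : measurable_fun (lset D) (fun _ => B%:E) by exact: measurable_cst.
apply: (le_trans (ge0_le_integral leb mD h0 mE mB _)).
  by move=> s /hB/andP[_ hB']; rewrite lee_fin.
rewrite (integral_cst leb mD) EFinM lee_wpmul2l ?lee_fin//.
rewrite -[X in (_ <= X)%E](leb_cc t0); apply: le_measure => //; rewrite inE//.
exact: leb_measurable_itv.
Qed.

Lemma ge0_integral_le_add (h k : R -> R) (c t : R) : 0 <= t -> 0 <= c ->
  measurable_fun (lset `[0%R, t]) h -> measurable_fun (lset `[0%R, t]) k ->
  (forall s, 0 <= s <= t -> 0 <= h s) -> (forall s, 0 <= s <= t -> 0 <= k s) ->
  (forall s, 0 <= s <= t -> h s <= k s + c) ->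
  (\int[leb]_(s in lset `[0%R, t]) (h s)%:E <=
   \int[leb]_(s in lset `[0%R, t]) (k s)%:E + (c * t)%:E)%E.
Proof.
move=> t0 c0 mh mk h0 k0 hk.
have mt : measurable (lset `[0%R, t]) by exact: leb_measurable_itv.
have mhE : measurable_fun (lset `[0%R, t]) (fun s => (h s)%:E) by exact/measurable_EFinP.
have mkE : measurable_fun (lset `[0%R, t]) (fun s => (k s)%:E) by exact/measurable_EFinP.
have mc : measurable_fun (lset `[0%R, t]) (fun _ => c%:E) by exact: measurable_cst.
have h0E s : `[0, t]%classic s -> (0 <= (h s)%:E)%E.
  by rewrite /= in_itv/= lee_fin; exact: h0.
have k0E s : `[0, t]%classic s -> (0 <= (k s)%:E)%E.
  by rewrite /= in_itv/= lee_fin; exact: k0.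
have c0E (s : R) : `[0, t]%classic s -> (0 <= c%:E)%E by rewrite lee_fin.
have mkc : measurable_fun (lset `[0%R, t]) (fun s => ((k s)%:E + c%:E)%E).
  exact: emeasurable_funD.
apply: (le_trans (ge0_le_integral leb mt h0E mhE mkc _)).
  by move=> s; rewrite /= in_itv/= -EFinD lee_fin; exact: hk.
have -> := ge0_integralD leb mt k0E mkE c0E mc.
by rewrite leeD2l// (integral_cst leb mt) [X in (_ * X)%E](leb_cc t0) EFinM.
Qed.

End leb_bounds.

(** * Value functions *)

Section value_functions.
Context {R : realType} (n m : nat).
Variables (A : set 'rV[R]_m) (T : set 'rV[R]_n).
Variables (f : 'rV[R]_n -> 'rV[R]_m -> 'rV[R]_n) (l rho : 'rV[R]_n -> 'rV[R]_m -> R).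
Variable y : 'rV[R]_n -> (R -> 'rV[R]_m) -> R -> 'rV[R]_n.
Hypothesis T_closed : closed T.
Hypothesis f_growth : exists2 M : R, 0 < M &
  forall x a, A a -> `|f x a| <= M * (1 + `|x|).
Hypothesis f_lipschitz : forall r : R, 0 < r -> exists2 L : R, 0 < L &
  forall (x1 x2 : 'rV[R]_n) a, `|x1| <= r -> `|x2| <= r -> A a ->
    `|f x1 a - f x2 a| <= L * `|x1 - x2|.
Hypothesis l_lipschitz : forall r : R, 0 < r -> exists2 L : R, 0 < L &
  forall (x1 x2 : 'rV[R]_n) a, `|x1| <= r -> `|x2| <= r -> A a ->
    `|l x1 a - l x2 a| <= L * `|x1 - x2|.
Hypothesis y_solution :
  forall x al, controls A al -> is_solution f x al (y x al).
Hypothesis l_cost : running_cost A l.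
Hypothesis rho_cost : running_cost A rho.
Hypothesis rho_bounded : forall r : R, exists2 B : R, 0 < B &
  forall x a, `|x| <= r -> A a -> rho x a <= B.

Let V := value A T y l.
Let Vf := value_fin A T y l.
Let U := value_rho A T y l rho.
Let Veps := value_eps A T y l rho.

Lemma value_in x : T x -> V x = 0%E.
Proof. by move=> Tx; rewrite /V /value mem_set. Qed.

Lemma value_rho_in x : T x -> U x = 0%E.
Proof. by move=> Tx; rewrite /U /value_rho mem_set. Qed.

Lemma value_eps_in e x : T x -> Veps e x = 0%E.
Proof. by move=> Tx; rewrite /Veps /value_eps mem_set. Qed.

Lemma value_le x al : ~ T x -> controls_to A T y x al -> (V x <= total_cost T y l x al)%E.
Proof.
by move=> nT cal; rewrite /V /value memNset//; apply: ereal_inf_lbound; exists al.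
Qed.

Lemma value_rho_le x al : ~ T x -> controls_to_rho A T y rho x al ->
  (U x <= total_cost T y l x al)%E.
Proof.
by move=> nT cal; rewrite /U /value_rho memNset//; apply: ereal_inf_lbound; exists al.
Qed.

Lemma value_eps_le e x al : ~ T x -> controls_to A T y x al ->
  (Veps e x <= total_cost T y (fun z a => l z a + e * rho z a)%R x al)%E.
Proof.
by move=> nT cal; rewrite /Veps /value_eps memNset//; apply: ereal_inf_lbound; exists al.
Qed.

Lemma value_lt x (u : \bar R) : ~ T x -> (V x < u)%E ->
  exists2 al, controls_to A T y x al & (total_cost T y l x al < u)%E.
Proof.
by rewrite /V /value => nT; rewrite memNset// => /ereal_inf_lt[_ [al cal <-] ?]; exists al.
Qed.

Lemma value_rho_lt x (u : \bar R) : ~ T x -> (U x < u)%E ->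
  exists2 al, controls_to_rho A T y rho x al & (total_cost T y l x al < u)%E.
Proof.
by rewrite /U /value_rho => nT; rewrite memNset// => /ereal_inf_lt[_ [al cal <-] ?]; exists al.
Qed.

Lemma value_eps_lt e x (u : \bar R) : ~ T x -> (Veps e x < u)%E ->
  exists2 al, controls_to A T y x al &
    (total_cost T y (fun z a => l z a + e * rho z a)%R x al < u)%E.
Proof.
by rewrite /Veps /value_eps => nT; rewrite memNset// => /ereal_inf_lt[_ [al cal <-] ?]; exists al.
Qed.

Lemma value_ge0 x : (0 <= V x)%E.
Proof.
rewrite /V /value; case: ifP => // _; apply: le_ereal_inf_tmp => _ [al [cal _] <-].
exact: total_cost_ge0 cal.
Qed.

Lemma value_le_value_rho x : (V x <= U x)%E.
Proof.
have [Tx|nT] := pselect (T x); first by rewrite value_in// value_rho_in.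
rewrite /U /value_rho memNset//; apply: le_ereal_inf_tmp => _ [al [cal _] <-].
exact: value_le.
Qed.

Lemma value_rho_ge0 x : (0 <= U x)%E.
Proof. exact: le_trans (value_ge0 x) (value_le_value_rho x). Qed.

(** A control of finite rho-cost competes in U; for any other, e > 0 makes the penalized cost
    +oo. *)
Lemma value_rho_le_value_eps e x : 0 < e -> (U x <= Veps e x)%E.
Proof.
move=> e0; have [Tx|nT] := pselect (T x); first by rewrite value_eps_in// value_rho_in.
rewrite /Veps /value_eps memNset//; apply: le_ereal_inf_tmp => _ [al cal <-].
have c1 := total_cost_ge0 T y x l_cost cal.1; have c2 := total_cost_ge0 T y x rho_cost cal.1.
rewrite (total_costD _ f_growth y_solution x (ltW e0) l_cost rho_cost cal.1).
have [c2oo|] := ltP (total_cost T y rho x al) +oo%E.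
  apply: (le_trans (value_rho_le nT (conj cal c2oo))).
  by rewrite leeDl// mule_ge0// lee_fin ltW.
rewrite leye_eq => /eqP ->; rewrite gt0_muley ?lte_fin// addey ?leey//.
by rewrite -ltNye (lt_le_trans _ c1).
Qed.

Lemma value_eps_mono e e' x : 0 <= e -> e <= e' -> (Veps e x <= Veps e' x)%E.
Proof.
move=> e0 ee'; have [Tx|nT] := pselect (T x); first by rewrite !value_eps_in.
rewrite [leRHS]/Veps /value_eps memNset//; apply: le_ereal_inf_tmp => _ [al cal <-].
apply: (le_trans (value_eps_le e nT cal)).
have tcD c (c0 : 0 <= c) := total_costD T f_growth y_solution x c0 l_cost rho_cost cal.1.
rewrite !tcD ?(le_trans e0)// leeD2l// lee_wpmul2r ?lee_fin//.
exact: total_cost_ge0 cal.1.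
Qed.

Lemma value_eps_cvg x : ~ T x -> Veps e x @[e --> 0^'+] --> U x.
Proof.
move=> nT; have [Uoo|] := eqVneq (U x) +oo%E.
  rewrite Uoo; apply: cvg_near_cst; near=> e.
  have e0 : 0 < e by near: e; exact: nbhs_right_gt.
  by apply/eqP; rewrite -leye_eq -Uoo value_rho_le_value_eps.
rewrite -ltey -ge0_fin_numE ?value_rho_ge0// => /fineK; set u := fine _ => uE.
rewrite -uE => N /(nbhs_ballP (u : R))[d /= d0 dN].
have [al [cal rfin] lal] : exists2 al, controls_to_rho A T y rho x al &
    (total_cost T y l x al < (u + d / 2)%:E)%E.
  by apply: value_rho_lt => //; rewrite -uE lte_fin ltrDl divr_gt0.
have c2 := total_cost_ge0 T y x rho_cost cal.1.
have : total_cost T y rho x al \is a fin_num by rewrite ge0_fin_numE.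
move=> /fineK; set c := fine _ => cE.
have c0 : 0 <= c by rewrite -lee_fin cE.
have c10 : 0 < c + 1 by rewrite ltr_wpDl.
(* This gives [e * c < d / 2]; the 1 covers a vanishing rho-cost c. *)
have : \forall e \near (0:R)^'+, 0 < e < d / 2 / (c + 1).
  near=> e; apply/andP; split; near: e; first exact: nbhs_right_gt.
  by apply: nbhs_right_lt; rewrite !divr_gt0.
apply: filterS => e /andP[e0 ed].
have UV := value_rho_le_value_eps x e0.
have Vu : (Veps e x < (u + d)%:E)%E.
  apply: (le_lt_trans (value_eps_le e nT cal)).
  rewrite (total_costD _ f_growth y_solution x (ltW e0) l_cost rho_cost cal.1) -cE.
  apply: (@lt_le_trans _ _ ((u + d / 2)%:E + (e * c)%:E)%E).
    by rewrite EFinM lte_leD.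
  rewrite -EFinD lee_fin -addrA lerD2l.
  move: ed; rewrite ltr_pdivlMr// => ed.
  have : e * c <= e * (c + 1) by rewrite ler_pM2l// lerDl.
  by lra.
have : Veps e x \is a fin_num.
  by rewrite ge0_fin_numE ?(le_trans (value_rho_ge0 x))// (lt_trans Vu) ?ltry.
move=> /fineK; set v := fine _ => vE.
have /= -> : Veps e x = v%:E by rewrite vE.
move: UV Vu; rewrite -uE -vE lee_fin lte_fin => uv vd.
by apply: dN; rewrite /ball/= ler0_norm ?subr_le0//; lra.
Unshelve. all: by end_near. Qed.

(** Before a finite hitting time the trajectory is bounded, hence so is rho along it: every control
    competing in Vf competes in U, and U <= Vf = V. *)
Lemma value_fin_eq_value_rho : Vf =1 V -> U =1 V.
Proof.
move=> VfV x; apply/eqP; rewrite eq_le value_le_value_rho andbT.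
have [Tx|nT] := pselect (T x); first by rewrite value_in// value_rho_in.
rewrite -VfV /Vf /value_fin memNset//; apply: le_ereal_inf_tmp => _ [al [cal hfin] <-].
have zlip := controlled_locally_lipschitz f_growth y_solution x cal.
apply: value_rho_le => //; split.
  split => //; apply: liminf_dist_hitting_fin => //.
  by rewrite (controlled_init y_solution).
have : hitting_time T (y x al) \is a fin_num by rewrite ge0_fin_numE// hitting_time_ge0.
move=> /fineK; set t := fine _ => tE.
have t0 : 0 <= t by rewrite -lee_fin tE hitting_time_ge0.
have F : follows f al (y x al) t by exact: solution_follows (y_solution x cal) t.
have [r r0 yr] := follows_bounded F.
have [B B0 rhoB] := rho_bounded r.
apply: (@le_lt_trans _ _ (B * t)%:E); last by rewrite ltry.
rewrite /total_cost /integral_upto -tE -/(upto t%:E).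
have Ut : upto t%:E `<=` `[0, t]%classic.
  by move=> s [s0]; rewrite /= in_itv/= s0 lte_fin => /ltW.
apply: (ge0_integral_bound t0 (ltW B0) (measurable_upto _) Ut).
  apply: measurable_funS (measurable_running_cost f_growth y_solution x rho_cost cal).
    exact: leb_measurable_itv.
  exact: upto_sub.
move=> s /[dup] -[s0 _] /Ut; rewrite /= in_itv/= => st.
have As := cal.1 s s0; rewrite rho_cost.1//= rhoB//; exact: yr.
Qed.

(** Provides the switching time. It is finite and strictly before the hitting time, even when the
    latter is +oo, and the path is still outside T, as concatenation demands. *)
Lemma near_target_time x al (e : R) : ~ T x -> controls_to A T y x al -> 0 < e ->
  exists t : R, [/\ 0 < t, (t%:E < hitting_time T (y x al))%E,
    (forall s : R, 0 <= s <= t -> ~ T (y x al s)) &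
    exists2 p, T p & `|y x al t - p| < e].
Proof.
move=> nT [cal /liminf_dist_eq0P lim] e0.
have zlip := controlled_locally_lipschitz f_growth y_solution x cal.
have h0 : (0 < hitting_time T (y x al))%E.
  by apply: hitting_time_gt0 => //; rewrite (controlled_init y_solution).
have [t [t0 th yp]] := lim (ltW h0) e 0 e0 h0.
exists t; split => // s /andP[s0 st].
have sh : (s%:E < hitting_time T (y x al))%E by apply: le_lt_trans th; rewrite lee_fin.
exact: lt_hitting_time s0 sh.
Qed.

Lemma small_near_target_value_rho : small_near_target T U -> U =1 V.
Proof.
move=> small x; apply/eqP; rewrite eq_le value_le_value_rho andbT.
have [Tx|nT] := pselect (T x); first by rewrite value_in// value_rho_in.
have [Voo|] := eqVneq (V x) +oo%E; first by rewrite Voo leey.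
rewrite -ltey -ge0_fin_numE ?value_ge0// => /fineK; set v := fine _ => vE.
rewrite -vE; apply/lee_addgt0Pr => d d0.
(* Half of d is the defect of a nearly optimal control, half the cost after the switch. *)
have d20 : 0 < d / 2 by rewrite divr_gt0.
have [e e0 small_e] := small _ d20.
have [al cal lal] : exists2 al, controls_to A T y x al &
    (total_cost T y l x al < (v + d / 2)%:E)%E.
  by apply: value_lt => //; rewrite -vE lte_fin ltrDl.
have [t [t0 th nTt [p Tp yp]]] := near_target_time nT cal e0.
have nTyt : ~ T (y x al t) by apply: nTt; rewrite lexx ltW.
have [be cbe lbe] := value_rho_lt nTyt (small_e _ _ nTyt Tp yp).
have cbe' := cbe.1.1.
have cost_concat := total_cost_concat T_closed f_growth f_lipschitz y_solution
  (ltW t0) cal.1 cbe' nTt.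
have cc : controls_to_rho A T y rho x (concat t al be).
  split; first exact: (controls_to_concat T_closed f_growth f_lipschitz y_solution
    (ltW t0) cal.1 cbe' nTt cbe.1).
  rewrite cost_concat//; apply: lte_add_pinfty; last exact: cbe.2.
  have F : follows f al (y x al) t by exact: solution_follows (y_solution x cal.1) t.
  have [r r0 yr] := follows_bounded F.
  have [B B0 rhoB] := rho_bounded r.
  apply: (@le_lt_trans _ _ (B * t)%:E); last by rewrite ltry.
  apply: (ge0_integral_bound (ltW t0) (ltW B0) (leb_measurable_itv _)).
  - by [].
  - apply: measurable_funS (measurable_running_cost f_growth y_solution x rho_cost cal.1).
      exact: leb_measurable_itv.
    by move=> s /=; rewrite !in_itv/= => /andP[->].
  - move=> s; rewrite /= in_itv/= => st; have /andP[s0 _] := st.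
    have As := cal.1.1 s s0; rewrite rho_cost.1//= rhoB//; exact: yr.
apply: (le_trans (value_rho_le nT cc)); rewrite cost_concat//.
have -> : (v%:E + d%:E = (v + d / 2)%:E + (d / 2)%:E)%E.
  by rewrite -!EFinD; congr (_%:E); lra.
apply: leeD (ltW lbe).
apply: le_trans (ltW lal).
exact: (total_cost_prefix f_growth y_solution l_cost cal.1 th).
Qed.

(* The time t is chosen before e1, so that finiteness of the rho-cost of the
   nearly optimal control of x0 is not needed. *)
Lemma value_eps_local_bound (eb : R) x0 (d : R) : 0 < eb ->
  small_near_target T (Veps eb) -> ~ T x0 -> (V x0 < +oo)%E -> 0 < d ->
  exists2 r : R, 0 < r & exists2 e1 : R, 0 < e1 &
    forall e x, 0 < e -> e < e1 -> `|x0 - x| < r -> (Veps e x < V x0 + d%:E)%E.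
Proof.
move=> eb0 small nT0 Vfin d0.
have : V x0 \is a fin_num by rewrite ge0_fin_numE ?value_ge0.
move=> /fineK; set v := fine _ => vE.
(* One share for the defect of [al], two for the changes of l and of e rho over [[0, t]], one for
   the tail; the fifth keeps the final inequality strict. *)
pose q := d / 5.
have q0 : 0 < q by rewrite divr_gt0.
have [e0 e00 small_e] := small _ q0.
(* The trajectory from x0 is brought within [e0 / 2] of T, leaving as much for its distance to the
   one from x. *)
have e02 : 0 < e0 / 2 by rewrite divr_gt0.
have [al cal lal] : exists2 al, controls_to A T y x0 al &
    (total_cost T y l x0 al < (v + q)%:E)%E.
  by apply: value_lt => //; rewrite -vE lte_fin ltrDl.
have [t [t0 th nTt [p Tp yp]]] := near_target_time nT0 cal e02.
have zlip := controlled_locally_lipschitz f_growth y_solution x0 cal.1.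
have [d1 d10 away] := path_away_from_target T_closed zlip nTt.
have [C C0 stable] := controlled_stable f_growth f_lipschitz y_solution (`|x0| + 1) t.
have [r r0 yr] := controlled_bounded f_growth y_solution (`|x0| + 1) t.
have [L L0 lL] := l_lipschitz r0.
have [B B0 rhoB] := rho_bounded r.
have t10 : 0 < t + 1 by rewrite addr_gt0.
(* A pointwise error k integrates to at most q over [[0, t]]. *)
pose k := q / (t + 1).
have k0 : 0 < k by rewrite divr_gt0.
have kt : k * t <= q.
  by rewrite /k mulrAC ler_pdivrMr// ler_pM2l// lerDl.
(* In order: x stays in the ball where C and r are valid; the trajectory from x under [al] avoids T
   up to t; it ends within e0 of T; l changes by at most k along it. *)
exists (Num.min 1 (Num.min (d1 / C) (Num.min (e0 / 2 / C) (k / (L * C))))).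
  by rewrite !lt_min ltr01 !divr_gt0// mulr_gt0.
(* Below [eb], monotonicity in e transfers the smallness of [Veps eb] near T; below [k / B], the
   term e rho is at most k. *)
exists (Num.min eb (k / B)); first by rewrite lt_min eb0 divr_gt0.
move=> e x ep; rewrite !lt_min => /andP[eeb eB] /and4P[x1 xd xe xl].
have xn : `|x| <= `|x0| + 1.
  rewrite -[x](subrK x0) (le_trans (ler_normD _ _))// addrC lerD2l distrC.
  exact: ltW.
have x0n : `|x0| <= `|x0| + 1 by rewrite lerDl.
pose z := y x0 al; pose w := y x al.
have zw (s : R) : 0 <= s <= t -> `|z s - w s| <= C * `|x0 - x|.
  by move=> st; exact: stable cal.1 s st.
have nTw (s : R) : 0 <= s <= t -> ~ T (w s).
  move=> st Tw; have := away s (w s) st Tw; rewrite leNgt => /negP; apply.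
  by apply: (le_lt_trans (zw s st)); rewrite mulrC -ltr_pdivlMr.
have tt : 0 <= t <= t by rewrite lexx ltW.
have wtp : `|w t - p| < e0.
  rewrite -(subrKA (z t)) (le_lt_trans (ler_normD _ _))// distrC.
  have := zw t tt; move: xe; rewrite ltr_pdivlMr// mulrC => xe wz.
  move: yp; rewrite -/z => yp; lra.
have nTwt : ~ T (w t) by exact: nTw.
have nTx : ~ T x.
  have w0 : w 0 = x by exact: solution_init (y_solution x cal.1).
  by rewrite -w0; apply: nTw; rewrite lexx ltW.
have [be cbe lbe] : exists2 be, controls_to A T y (w t) be &
    (total_cost T y (fun z a => l z a + e * rho z a)%R (w t) be < q%:E)%E.
  apply: value_eps_lt => //; apply: le_lt_trans (small_e _ _ nTwt Tp wtp).
  by apply: value_eps_mono; exact: ltW.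
have ecost : running_cost A (fun z a => l z a + e * rho z a).
  by apply: running_costD => //; exact: ltW.
have cc : controls_to A T y x (concat t al be).
  exact: (controls_to_concat T_closed f_growth f_lipschitz y_solution (ltW t0) cal.1 cbe.1 nTw cbe).
apply: (le_lt_trans (value_eps_le e nTx cc)).
rewrite (total_cost_concat T_closed f_growth f_lipschitz y_solution
  (ltW t0) cal.1 cbe.1 nTw ecost).
have sub0t : (`[0, t] : set R) `<=` `[0, +oo[%classic.
  by move=> s /=; rewrite !in_itv/= => /andP[->].
have mrest g x' : running_cost A g -> measurable_fun (lset `[0%R, t]) (fun s => g (y x' al s) (al s)).
  move=> cg; apply: measurable_funS (measurable_running_cost f_growth y_solution x' cg cal.1).
    exact: leb_measurable_itv.
  exact: sub0t.
have bound : (\int[leb]_(s in lset `[0%R, t]) (l (w s) (al s) + e * rho (w s) (al s))%:E <=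
   \int[leb]_(s in lset `[0%R, t]) (l (z s) (al s))%:E + ((k + k) * t)%:E)%E.
  apply: ge0_integral_le_add.
  - exact: ltW.
  - by rewrite addr_ge0// ltW.
  - exact: (mrest (fun z a => l z a + e * rho z a) x ecost).
  - exact: mrest.
  - by move=> s /andP[s0 _]; apply: ecost.1; exact: cal.1.1.
  - by move=> s /andP[s0 _]; apply: l_cost.1; exact: cal.1.1.
  move=> s st; have /andP[s0 _] := st; have As := cal.1.1 s s0.
  rewrite addrA; apply: lerD.
    rewrite -lerBlDl; apply: (le_trans (ler_norm _)).
    apply: (le_trans (lL _ _ _ (yr x al xn cal.1 s st) (yr x0 al x0n cal.1 s st) As)).
    move: xl; rewrite ltr_pdivlMr ?mulr_gt0// => xl.
    apply: le_trans (ltW xl); rewrite [leRHS]mulrC -[leRHS]mulrA ler_pM2l// distrC.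
    exact: zw.
  apply: (@le_trans _ _ (e * B)).
    by rewrite ler_pM2l//; apply: rhoB => //; exact: (yr x al xn cal.1 s st).
  by move: eB; rewrite ltr_pdivlMr// => /ltW.
apply: (@le_lt_trans _ _ ((v + q)%:E + ((k + k) * t)%:E + q%:E)%E).
  apply: leeD (ltW lbe); apply: (le_trans bound); rewrite leeD2r//.
  apply: le_trans (ltW lal).
  exact: (total_cost_prefix f_growth y_solution l_cost cal.1 th).
rewrite -vE -!EFinD lte_fin.
have -> : d = 5 * q by rewrite /q; field.
by rewrite mulrDl; lra.
Qed.

End value_functions.

(** * Pointwise limit, equality of the values and uniformity on compact sets *)

Theorem theorem3p3 (R : realType) (n m : nat)
    (A : set 'rV[R]_m) (T : set 'rV[R]_n)
    (f : 'rV[R]_n -> 'rV[R]_m -> 'rV[R]_n)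
    (l : 'rV[R]_n -> 'rV[R]_m -> R)
    (y : 'rV[R]_n -> (R -> 'rV[R]_m) -> R -> 'rV[R]_n)
    (rho : 'rV[R]_n -> 'rV[R]_m -> R)
    (A_compact : compact A)
    (T_closed : closed T)
    (bdT_compact : compact (boundary T))
    (f_continuous : {within [set: 'rV[R]_n] `*` A,
       continuous (fun p : 'rV[R]_n * 'rV[R]_m => f p.1 p.2)})
    (l_continuous : {within [set: 'rV[R]_n] `*` A,
       continuous (fun p : 'rV[R]_n * 'rV[R]_m => l p.1 p.2)})
    (l_ge0 : forall x a, A a -> 0 <= l x a)
    (f_growth : exists2 M : R, 0 < M &
       forall x a, A a -> `|f x a| <= M * (1 + `|x|))
    (fl_lipschitz : forall r : R, 0 < r -> exists2 L : R, 0 < L &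
       forall x1 x2 a, `|x1| <= r -> `|x2| <= r -> A a ->
         `|f x1 a - f x2 a| <= L * `|x1 - x2| /\
         `|l x1 a - l x2 a| <= L * `|x1 - x2|)
    (y_solution : forall x al, controls A al -> is_solution f x al (y x al))
    (rho_continuous : {within [set: 'rV[R]_n] `*` A,
       continuous (fun p : 'rV[R]_n * 'rV[R]_m => rho p.1 p.2)})
    (rho_ge0 : forall x a, A a -> 0 <= rho x a) :
  let V := value A T y l in
  let Vf := value_fin A T y l in
  let U := value_rho A T y l rho in
  let Veps := value_eps A T y l rho in
  ((forall x, (~` T) x -> Veps eps x @[eps --> 0^'+] --> U x) /\
   (Vf =1 V \/ continuous_on_boundary T U -> U =1 V)) /\
  ((exists2 eps : R, 0 < eps & continuous_on_boundary T (Veps eps)) ->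
   {within dom T V, continuous V} ->
   U =1 V /\
   forall Q : set 'rV[R]_n, compact Q -> Q `<=` dom T V ->
     forall eta : R, 0 < eta ->
       \forall eps \near 0^'+, forall x, Q x ->
         (`|Veps eps x - U x| < eta%:E)%E).
Proof.
move=> V Vf U Veps.
have f_lipschitz (r : R) : 0 < r -> exists2 L : R, 0 < L &
    forall (x1 x2 : 'rV[R]_n) a, `|x1| <= r -> `|x2| <= r -> A a ->
      `|f x1 a - f x2 a| <= L * `|x1 - x2|.
  move=> /fl_lipschitz[L L0 fL]; exists L => // x1 x2 a x1r x2r Aa.
  by have [] := fL x1 x2 a x1r x2r Aa.
have l_lipschitz (r : R) : 0 < r -> exists2 L : R, 0 < L &
    forall (x1 x2 : 'rV[R]_n) a, `|x1| <= r -> `|x2| <= r -> A a ->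
      `|l x1 a - l x2 a| <= L * `|x1 - x2|.
  move=> /fl_lipschitz[L L0 fL]; exists L => // x1 x2 a x1r x2r Aa.
  by have [] := fL x1 x2 a x1r x2r Aa.
have l_cost : running_cost A l by exact: continuous_running_cost.
have rho_cost : running_cost A rho by exact: continuous_running_cost.
have rho_bounded (r : R) : exists2 B : R, 0 < B &
    forall (x : 'rV[R]_n) a, `|x| <= r -> A a -> rho x a <= B.
  exact: continuous_bounded_on_ball.
have U_le_Veps (e : R) x : 0 < e -> (U x <= Veps e x)%E.
  exact: (value_rho_le_value_eps T f_growth y_solution l_cost rho_cost).
have U_ge0 x : (0 <= U x)%E := value_rho_ge0 T rho y l_cost x.
have UT x : T x -> U x = 0%E by move=> Tx; exact: value_rho_in.
have VepsT (e : R) x : T x -> Veps e x = 0%E by move=> Tx; exact: value_eps_in.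
have small_UV : small_near_target T U -> U =1 V.
  exact: (small_near_target_value_rho T_closed f_growth f_lipschitz y_solution
    l_cost rho_cost rho_bounded).
split; first split.
- move=> x nTx.
  exact: (value_eps_cvg f_growth y_solution l_cost rho_cost nTx).
- case=> [VfV|Ucont].
    exact: (value_fin_eq_value_rho T_closed f_growth y_solution rho_cost rho_bounded VfV).
  by apply: small_UV; exact: continuous_small_near_target.
move=> [eb eb0 ebcont] Vcont.
have small_eb : small_near_target T (Veps eb).
  by apply: continuous_small_near_target => // x; exact: VepsT.
have UV : U =1 V.
  (* U lies below [Veps eb], so it inherits smallness near T without being known to be continuous
     there. *)
  apply: small_UV => d d0; have [e e0 small_e] := small_eb d d0.
  exists e => // z p nTz Tp zp; apply: le_lt_trans (small_e z p nTz Tp zp).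
  exact: U_le_Veps.
split=> // Q /compact_near_coveringP/near_covering_withinP covQ Qdom eta eta0.
(* Compactness reduces uniformity to an estimate for x in Q near x0 and small eps jointly. *)
apply: covQ => x0 Qx0; have [_ Vx0] := Qdom x0 Qx0.
(* Used with a = [Veps eps x], b = [U x] and c = [V x0], or c = 0 when x0 is in T. The inequalities
   force all three to be finite. *)
have near_lt (a b c : \bar R) : (0 <= b)%E -> (b <= a)%E -> (a < c + (eta / 2)%:E)%E ->
    (c < b + (eta / 2)%:E)%E -> (`|a - b| < eta%:E)%E.
  case: b => [b| |]//; case: a => [a| |]//; case: c => [c| |]//.
  rewrite -!EFinD !lee_fin !lte_fin => _ ba ac cb.
  by rewrite ger0_norm ?subr_ge0//; lra.
have eta20 : 0 < eta / 2 by rewrite divr_gt0.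
(* At a point of T there is no control to perturb: smallness of [Veps eb] near T takes its place. *)
have [Tx0|nTx0] := pselect (T x0).
  have [e e0 small_e] := small_eb _ eta20.
  exists (ball x0 e, [set eps | 0 < eps < eb]).
    split => /=; first exact: nbhsx_ballx.
    near=> eps; apply/andP; split; near: eps; first exact: nbhs_right_gt.
    exact: nbhs_right_lt.
  move=> [x eps] [/= x0x /andP[eps0 epseb]] Qx.
  apply: (near_lt _ _ 0%E) => //; first exact: U_le_Veps; last first.
    by apply: lt_le_trans (_ : ((eta / 2)%:E <= _)%E); rewrite ?lte_fin ?leeDr.
  rewrite add0e; have [Tx|nTx] := pselect (T x); first by rewrite VepsT ?lte_fin.
  apply: le_lt_trans (small_e x x0 nTx Tx0 _).
    by apply: (value_eps_mono T f_growth y_solution l_cost rho_cost); exact: ltW.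
  by move: x0x; rewrite mx_norm_ball /ball_/= distrC.
have [r r0 [e1 e10 bound]] := value_eps_local_bound T_closed f_growth f_lipschitz
  l_lipschitz y_solution l_cost rho_cost rho_bounded eb0 small_eb nTx0 Vx0 eta20.
(* The switching bound compares [Veps eps x] with [V x0], not with [V x]; this excludes that V drops
   at points of its domain near x0. *)
have Vlsc : \forall x \near x0, dom T V x -> (V x0 < V x + (eta / 2)%:E)%E.
  have /subspace_continuousP/(_ x0 (Qdom _ Qx0)) Vv := Vcont.
  have : V x0 \is a fin_num by rewrite ge0_fin_numE// -UV.
  move=> /fineK; set v := fine _ => vE.
  have nv : nbhs (V x0) [set u | ((v - eta / 2)%:E < u)%E].
    by rewrite -vE; apply: open_ereal_gt'; rewrite lte_fin ltrBlDr ltrDl.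
  have nx : nbhs x0 [set x | dom T V x -> ((v - eta / 2)%:E < V x)%E] := Vv _ nv.
  apply: filterS nx => x /= /[apply].
  by rewrite -vE EFinB lteBlDr.
move/nbhs_ballP : Vlsc => [r' /= r'0 Vlsc].
exists (ball x0 (Num.min r r'), [set eps | 0 < eps < e1]).
  split => /=; first by apply: nbhsx_ballx; rewrite lt_min r0.
  near=> eps; apply/andP; split; near: eps; first exact: nbhs_right_gt.
  exact: nbhs_right_lt.
move=> [x eps] [/= x0x /andP[eps0 epse]] Qx.
move: x0x; rewrite mx_norm_ball /ball_/= lt_min => /andP[x0r x0r'].
apply: (near_lt _ _ (V x0)); [exact: U_ge0|exact: U_le_Veps|exact: bound|].
by rewrite UV; apply: Vlsc; [rewrite mx_norm_ball|exact: Qdom].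
Unshelve. all: by end_near. Qed.
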